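(* For each $k$ there exists an effectively computable positive constant $C_1(k)$, depending only on $k$, such that the following holds: if a quadruple of integers $N, M, a, b$ satisfies $\sigma(N)=aM$, $\sigma(M)=bN$ and $\omega(\sigma(N))\leq k$, and both $M$ and $N$ are odd, then each of $M$ and $N$ must have a prime factor smaller than $C_1(k)$.
   Context: $\sigma(n)$ denotes the sum of the positive divisors of a positive integer $n$ (so $N$ and $M$ are positive integers), and $\omega(n)$ denotes the number of distinct prime factors of $n$.
   Formalization: The formal statement excludes the single pair N = M = 1, for which the claim fails literally (a = b = 1 satisfies every hypothesis, but 1 has no prime factor). *)

(* Defs.v *)
From mathcomp Require Import all_boot.

Set Implicit Arguments.
Unset Strict Implicit.
Unset Printing Implicit Defensive.

Definition sigma (n : nat) : nat := \sum_(d <- divisors n) d.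

Definition omega (n : nat) : nat := size (primes n).

(** Total recursive functions of several natural variables: the least class
    containing zero, successor and the projections, and closed under
    composition, primitive recursion and minimisation of regular functions
    (so that no partial function ever appears).  Each closure rule
    characterises the new function [h] by pointwise equations, which makes the
    class closed under extensional equality. *)
Inductive recursive : forall n : nat, (n.-tuple nat -> nat) -> Prop :=
| rec_zero :
    recursive (fun _ : 0.-tuple nat => 0)
| rec_succ :
    recursive (fun v : 1.-tuple nat => (thead v).+1)
| rec_proj (n : nat) (i : 'I_n) :
    recursive (fun v : n.-tuple nat => tnth v i)
| rec_comp (m n : nat) (f : m.-tuple nat -> nat)
    (g : 'I_m -> n.-tuple nat -> nat) (h : n.-tuple nat -> nat) :
    recursive f -> (forall i, recursive (g i)) ->
    (forall v, h v = f [tuple g i v | i < m]) ->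
    recursive h
| rec_prim (n : nat) (f : n.-tuple nat -> nat)
    (g : n.+2.-tuple nat -> nat) (h : n.+1.-tuple nat -> nat) :
    recursive f -> recursive g ->
    (forall v : n.-tuple nat, h [tuple of 0 :: v] = f v) ->
    (forall (x : nat) (v : n.-tuple nat),
       h [tuple of x.+1 :: v] = g [tuple of x :: h [tuple of x :: v] :: v]) ->
    recursive h
| rec_min (n : nat) (f : n.+1.-tuple nat -> nat) (h : n.-tuple nat -> nat) :
    recursive f ->
    (forall v : n.-tuple nat, f [tuple of h v :: v] = 0 /\
               forall y, y < h v -> f [tuple of y :: v] <> 0) ->
    recursive h.

(** A constant depending on [k] is effectively computable when it is given by
    a (total) recursive function of [k]. *)
Definition effectively_computable (C : nat -> nat) : Prop :=
  recursive (fun v : 1.-tuple nat => C (thead v)).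

(* Main.v *)
(** Let h = ab, so that sigma(N)/N * sigma(M)/M = h >= 2.  Suppose all primes of M
    exceed a huge C.  Then sigma(M)/M is barely above 1, so sigma(N)/N is barely below h.
    Let N0 be the product of the p^e || N with sigma(p^e) < C: as sigma(N0) is prime to M,
    it divides a, which is bounded.  The other small primes of N carry huge exponents, so
    sigma(N)/N is close to Q = sigma(N0)/N0 * prod p/(p-1) over the primes of N below a
    well-chosen gap.  Since N is odd, Q = h is impossible by parity, and then |Q - h| is at
    least the inverse of a bounded denominator.  Exchanging N and M treats the primes of N.

    This needs two facts about the primes p with sigma(p^e) built from k given primes: those
    with large_exponent e are boundedly many, and all of them are so sparse that sum 1/p has a small
    tail.  For small e one counts integers built from k primes.  For large_exponent e, a prime q
    with the largest power in sigma(p^e) satisfies e << q^2, so if several such p share q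
    their exponents satisfy log e' << e log p.  On the other hand, a multiplicative relation
    between 2k values sigma(p_i^e_i) makes a linear form in the logarithms of the p_i and
    p_i - 1 as small as 2^(-min e_i), and Baker's theorem then gives
    min e_i <= (c log p log max e_i)^d.  Using this twice contradicts the previous bound.

    Baker's theorem is proved over the reals: Siegel's lemma provides an exponential
    polynomial with many zeros, Hermite interpolation (by Rolle's theorem) extrapolates
    the zeros from an interval of integers to a longer one, and a Vandermonde argument ends
    the proof.  Every constant is a closed expression in +, *, ^, hence recursive in k. *)

Require Import Defs.
From mathcomp Require Import all_boot all_order all_algebra cyclic.
From mathcomp Require Import all_classical all_reals all_analysis.
From mathcomp Require Import Rstruct zify ring lra.

Set Implicit Arguments.
Unset Strict Implicit.
Unset Printing Implicit Defensive.
Import Order.TTheory GRing.Theory Num.Theory numFieldNormedType.Exports.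

(** * Recursive functions *)

Lemma recursive_comp1 (F : nat -> nat) n (g : n.-tuple nat -> nat) :
  recursive (fun v : 1.-tuple nat => F (thead v)) -> recursive g ->
  recursive (fun v => F (g v)).
Proof.
move=> HF Hg; apply: (rec_comp (g := fun=> g) HF) => // v.
by rewrite /thead tnth_mktuple.
Qed.

Lemma recursive_comp2 (F : nat -> nat -> nat) n (g1 g2 : n.-tuple nat -> nat) :
  recursive (fun v : 2.-tuple nat => F (tnth v ord0) (tnth v (lift ord0 ord0))) ->
  recursive g1 -> recursive g2 -> recursive (fun v => F (g1 v) (g2 v)).
Proof.
move=> HF H1 H2.
apply: (rec_comp (g := fun i : 'I_2 => if i == ord0 then g1 else g2) HF) => [i|v].
  by case: ifP.
by rewrite !tnth_mktuple.
Qed.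

Lemma recursive_const n c : recursive (fun _ : n.-tuple nat => c).
Proof.
elim: c => [|c IH]; last exact: (recursive_comp1 rec_succ IH).
by apply: (rec_comp (g := fun i : 'I_0 => fun _ => 0) rec_zero) => // -[].
Qed.

Lemma recursive_primrec2 (F : nat -> nat -> nat) (G : nat -> nat -> nat) c :
  recursive (fun v : 2.-tuple nat => G (tnth v ord0) (tnth v (lift ord0 ord0))) ->
  (forall y, F 0 y = c y) ->
  recursive (fun v : 1.-tuple nat => c (thead v)) ->
  (forall x y, F x.+1 y = G (F x y) y) ->
  recursive (fun v : 2.-tuple nat => F (tnth v ord0) (tnth v (lift ord0 ord0))).
Proof.
move=> HG F0 Hc FS.
apply: (rec_prim (g := fun v : 3.-tuple nat =>
  G (tnth v (lift ord0 ord0)) (tnth v (lift ord0 (lift ord0 ord0)))) Hc).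
- by apply: recursive_comp2 => //; apply: rec_proj.
- by move=> v; rewrite /= !(tnth_nth 0) /= F0; case/tupleP: v => a v.
- by move=> x v; rewrite /= !(tnth_nth 0) /= FS.
Qed.

Lemma recursive_add :
  recursive (fun v : 2.-tuple nat => tnth v ord0 + tnth v (lift ord0 ord0)).
Proof.
apply: (recursive_primrec2 (G := fun a _ => a.+1) (c := id)) => //.
- exact: (recursive_comp1 rec_succ (rec_proj ord0)).
- exact: (rec_proj ord0).
Qed.

Lemma recursive_mul :
  recursive (fun v : 2.-tuple nat => tnth v ord0 * tnth v (lift ord0 ord0)).
Proof.
apply: (recursive_primrec2 (G := addn) (c := fun=> 0)) => //.
- exact: recursive_add.
- exact: recursive_const.
- by move=> x y; rewrite mulSn addnC.
Qed.

Lemma recursive_exp :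
  recursive (fun v : 2.-tuple nat => tnth v ord0 ^ tnth v (lift ord0 ord0)).
Proof.
(* Recursion runs on the first argument, so the exponent comes first here and the arguments are
   swapped back at the end. *)
have H : recursive (fun v : 2.-tuple nat =>
    (fun x y => y ^ x) (tnth v ord0) (tnth v (lift ord0 ord0))).
  apply: (recursive_primrec2 (F := fun x y => y ^ x) (G := muln) (c := fun=> 1)) => //.
  - exact: recursive_mul.
  - exact: recursive_const.
  - by move=> x y; rewrite expnS mulnC.
exact: (recursive_comp2 (F := fun x y => y ^ x) H (rec_proj _) (rec_proj _)).
Qed.

Lemma computable_id : effectively_computable id.
Proof. exact: (rec_proj ord0). Qed.

Lemma computable_const c : effectively_computable (fun=> c).
Proof. exact: recursive_const. Qed.

Lemma computable_succ f :
  effectively_computable f -> effectively_computable (fun k => (f k).+1).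
Proof. exact: recursive_comp1 rec_succ. Qed.

Lemma computable_add f g : effectively_computable f -> effectively_computable g ->
  effectively_computable (fun k => f k + g k).
Proof. exact: recursive_comp2 recursive_add. Qed.

Lemma computable_mul f g : effectively_computable f -> effectively_computable g ->
  effectively_computable (fun k => f k * g k).
Proof. exact: recursive_comp2 recursive_mul. Qed.

Lemma computable_exp f g : effectively_computable f -> effectively_computable g ->
  effectively_computable (fun k => f k ^ g k).
Proof. exact: recursive_comp2 recursive_exp. Qed.

(** * Sums of divisors *)

(** For a prime p this is sigma(p^(E - 1)): the second argument is the exponent plus one. *)
Definition repunit p E := \sum_(i < E) p ^ i.

Lemma repunitM p E : p.-1 * repunit p E = (p ^ E).-1.
Proof. by rewrite predn_exp. Qed.

Lemma repunit_gt0 p E : 0 < E -> 0 < repunit p E.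
Proof. by case: E => // E _; rewrite /repunit big_ord_recl expn0. Qed.

Lemma repunit_geX p E : p ^ E <= repunit p E.+1.
Proof. by rewrite /repunit big_ord_recr /= leq_addl. Qed.

Lemma repunit_ltX p E : 1 < p -> repunit p E < p ^ E.
Proof.
move=> p1; have := repunitM p E; have : 0 < p ^ E by rewrite expn_gt0; lia.
have : repunit p E <= p.-1 * repunit p E by rewrite leq_pmull //; lia.
lia.
Qed.

Lemma repunit_inj E : 1 < E -> injective (fun p => repunit p E).
Proof.
move=> E1 p q.
wlog lt : p q / p < q => [H|].
  by case: (ltngtP p q) => // [pq|pq] e; [|apply/esym]; apply: H.
suff : repunit p E < repunit q E by move=> + e; rewrite e ltnn.
case: E E1 => // -[//|E] _; rewrite /repunit !big_ord_recl /= !expn0 /bump /= !expn1.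
rewrite ltn_add2l -addSn leq_add //; apply: leq_sum => i _.
by rewrite leq_exp2r // ltnW.
Qed.

Lemma prime_dvd_repunit_ndvd p q E : 0 < E -> prime q -> q %| repunit p E -> ~~ (q %| p).
Proof.
case: E => // E _ pq; rewrite /repunit big_ord_recl expn0 => d; apply/negP => qp.
have : q %| 1.
  rewrite -(@dvdn_addl (\sum_(i < E) p ^ bump 0 i)) //.
  by apply: dvdn_sum => i _; rewrite /bump /= expnS dvdn_mulr.
by rewrite Euclid_dvd1.
Qed.

Lemma divisors_coprime_pfactor p e m : prime p -> 0 < m -> ~~ (p %| m) ->
  perm_eq (divisors (p ^ e * m)) [seq p ^ i * d | i <- iota 0 e.+1, d <- divisors m].
Proof.
move=> pp m0 pm; have p0 := prime_gt0 pp.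
have n0 : 0 < p ^ e * m by rewrite muln_gt0 expn_gt0 p0.
have lg i d : d %| m -> logn p (p ^ i * d) = i.
  move=> dm; have d0 := dvdn_gt0 m0 dm.
  rewrite lognM ?expn_gt0 ?p0 // pfactorK // (_ : logn p d = 0) ?addn0 //.
  apply/eqP; rewrite -leqn0 leqNgt logn_gt0 mem_primes pp d0 /=.
  by apply: contra pm => /dvdn_trans; apply.
apply: uniq_perm; first exact: divisors_uniq.
  apply: allpairs_uniq; rewrite ?iota_uniq ?divisors_uniq //.
  move: (iota 0 e.+1) => s -[i d] [j c].
  case/allpairsP => -[i' d'] /= [_ dm [-> ->]].
  case/allpairsP => -[j' c'] /= [_ cm [-> ->]] E.
  rewrite -!dvdn_divisors // in dm cm.
  have ij : i' = j' by rewrite -(lg i' d') // E lg.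
  by move: E => /eqP; rewrite ij eqn_pmul2l ?expn_gt0 ?p0 // => /eqP ->.
move: (iota 0 e.+1) (mem_iota 0 e.+1) => s sE d.
rewrite -dvdn_divisors //; apply/idP/allpairsP => [dn|[[i c] /= [ie cm ->]]]; last first.
  rewrite -dvdn_divisors // in cm; rewrite dvdn_mul // dvdn_exp2l //.
  by rewrite sE add0n ltnS in ie.
have d0 := dvdn_gt0 n0 dn; have [c pc dE] := pfactor_coprime pp d0.
exists (logn p d, c); split=> /=; last by rewrite mulnC.
  rewrite sE add0n ltnS; apply: leq_trans (dvdn_leq_log p n0 dn) _.
  by rewrite lg.
rewrite -dvdn_divisors // -(@Gauss_dvdr c (p ^ e) m).
  by apply: dvdn_trans dn; rewrite dE dvdn_mulr.
by rewrite coprimeXr // coprime_sym.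
Qed.

Lemma sigma_pfactor_mul p e m : prime p -> 0 < m -> ~~ (p %| m) ->
  sigma (p ^ e * m) = repunit p e.+1 * sigma m.
Proof.
move=> pp m0 pm; rewrite /sigma (perm_big _ (divisors_coprime_pfactor e pp m0 pm)) big_allpairs_dep.
rewrite /repunit -(big_mkord xpredT (fun i => p ^ i)) big_distrl /= /index_iota subn0.
by apply: eq_bigr => i _; rewrite big_distrr.
Qed.

Lemma sigma_prod (s : seq nat) (e : nat -> nat) : uniq s -> all prime s ->
  sigma (\prod_(p <- s) p ^ e p) = \prod_(p <- s) repunit p (e p).+1.
Proof.
elim: s => [|p s IH] /=; first by rewrite !big_nil /sigma (_ : divisors 1 = [:: 1]) ?big_seq1.
move=> /andP [ps us] /andP [pp als]; rewrite !big_cons sigma_pfactor_mul ?IH //.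
  rewrite big_seq; apply: prodn_cond_gt0 => q /(allP als) /prime_gt0 q0.
  by rewrite expn_gt0 q0.
rewrite big_seq; apply: (big_ind (fun y => ~~ (p %| y))) => [|y z Hy Hz|q qs].
- by rewrite Euclid_dvd1.
- by rewrite Euclid_dvdM // negb_or Hy.
rewrite Euclid_dvdX // negb_and (dvdn_prime2 pp (allP als q qs)).
by apply/orP; left; apply: contraNneq ps => ->.
Qed.

Lemma prod_primes n : 0 < n -> \prod_(p <- primes n) p ^ logn p n = n.
Proof.
move=> n0; rewrite [RHS]prod_prime_decomp // prime_decompE big_map /=.
by apply: eq_bigr.
Qed.

Lemma all_prime_primes n : all prime (primes n).
Proof. by apply/allP => p; rewrite mem_primes => /and3P []. Qed.

Lemma sigmaE n : 0 < n -> sigma n = \prod_(p <- primes n) repunit p (logn p n).+1.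
Proof.
by move=> n0; rewrite -{1}(prod_primes n0) sigma_prod ?primes_uniq ?all_prime_primes.
Qed.

Lemma sigma_gt0 n : 0 < n -> 0 < sigma n.
Proof. by move=> n0; rewrite sigmaE // prodn_gt0 // => p; apply: repunit_gt0. Qed.

Lemma repunit_mod1 x m d : x = 1 %[mod d] -> repunit x m = m %[mod d].
Proof.
move=> x1; rewrite /repunit -modn_summ.
under eq_bigr => i _ do rewrite -modnXm x1 modnXm exp1n.
by rewrite modn_summ sum1_card card_ord.
Qed.

(* Assuming x = 1 modulo q ^ 2 rather than modulo q covers the case q = 2. *)
Lemma lifting_exponent q x m j : prime q -> 0 < x -> 0 < m -> x = 1 %[mod q ^ 2] ->
  q ^ j %| (x ^ m).-1 -> q ^ j %| x.-1 * m.
Proof.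
move=> pq x0 m0 x1; have q0 := prime_gt0 pq.
elim/ltn_ind: m m0 j => m IH m0 j dv.
have [/dvdnP [m' mE]|qm] := boolP (q %| m); last first.
  move: dv; rewrite -repunitM Gauss_dvdl => [/dvdn_mulr|]; first exact.
  apply: coprimeXl; rewrite prime_coprime //; apply: contra qm.
  have dq : q %| q ^ 2 by rewrite dvdn_exp.
  by rewrite /dvdn (@repunit_mod1 x m q) // -(modn_dvdm x dq) x1 modn_dvdm.
have m'0 : 0 < m' by move: m0; rewrite mE muln_gt0 => /andP [].
case: j dv => [|j dv]; first by rewrite expn0 dvd1n.
pose y := x ^ m'.
have y1 : y = 1 %[mod q ^ 2] by rewrite /y -modnXm x1 modnXm exp1n.
have yE : (x ^ m).-1 = y.-1 * repunit y q by rewrite repunitM /y -expnM mE.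
have qq : q < q ^ 2 by rewrite expnS expn1 ltn_Pmulr ?prime_gt1.
(* As y = 1 modulo q^2, [repunit y q] is q modulo q^2: passing from m' to m brings in exactly one
   factor q. *)
have [u uE] : exists u, repunit y q = q * (1 + q * u).
  exists (repunit y q %/ q ^ 2); rewrite {1}(divn_eq (repunit y q) (q ^ 2)).
  by rewrite (repunit_mod1 _ y1) modn_small // expnS expn1; lia.
have cop : coprime (q ^ j) (1 + q * u).
  rewrite coprimeXl // prime_coprime // dvdn_addl ?dvdn_mulr // Euclid_dvd1 //.
have dy : q ^ j %| y.-1.
  move: dv; rewrite yE uE expnS mulnCA dvdn_pmul2l // Gauss_dvdl //.
rewrite mE mulnA expnSr dvdn_mul // IH // mE ltn_Pmulr ?prime_gt1 //.
Qed.

(** With m = z / (2b), c z is at most 2^(2bc + m); the exponent of its b-th power is 2b^2 c + m b,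
    and each term is at most z / 2. *)
Lemma exp_dominates_poly b c z : 0 < b -> 4 * b ^ 2 * c <= z -> (c * z) ^ b <= 2 ^ z.
Proof.
move=> b0 cz; set m := z %/ (2 * b).
have zm : z < 2 * b * m.+1 by rewrite mulnC -ltn_divLR ?muln_gt0 // ltnS.
have mz : m * (2 * b) <= z by apply: leq_trunc_div.
have H : c * z <= 2 * b * c * 2 ^ m.
  apply: (@leq_trans (c * (2 * b * m.+1))); first by rewrite leq_mul2l ltnW ?orbT.
  by rewrite mulnA [c * _]mulnC leq_mul2l ltn_expl ?orbT.
apply: (@leq_trans ((2 ^ (2 * b * c) * 2 ^ m) ^ b)).
  rewrite leq_exp2r //; apply: (leq_trans H); rewrite leq_mul2r; apply/orP; right.
  exact/ltnW/ltn_expl.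
rewrite -expnD -expnM leq_exp2l //.
by move: cz mz; rewrite expnS expn1; lia.
Qed.

(** * Integers composed of given primes *)

Definition smooth (P : seq nat) n := {subset primes n <= P}.

Lemma smooth_prod P n : 0 < n -> uniq P -> smooth P n -> n = \prod_(q <- P) q ^ logn q n.
Proof.
move=> n0 uP sP; rewrite (bigID (mem (primes n))) /= [X in _ * X]big1 ?muln1; last first.
  move=> q qn; have [pq|npq] := boolP (prime q); last by rewrite lognE (negPf npq).
  by move: qn; rewrite -logn_gt0 lt0n negbK => /eqP ->.
rewrite -big_filter -[LHS]prod_primes //; apply/perm_big/uniq_perm;
  rewrite ?primes_uniq ?filter_uniq //.
by move=> q; rewrite mem_filter; case: (boolP (q \in primes n)) => // /sP ->.
Qed.

(** If all the prime powers in n had a [size P]-th power below n, their product would give n^(size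
    P) <= (n - 1)^(size P). *)
Lemma smooth_big_part P n : 1 < n -> uniq P -> smooth P n ->
  exists q, [/\ q \in P, q %| n, prime q & n <= (q ^ logn q n) ^ size P].
Proof.
move=> n1 uP sP; have n0 := ltnW n1.
have [/hasP [q qP H]|/hasPn H] := boolP (has (fun q => n <= (q ^ logn q n) ^ size P) P).
  exists q; suff : q \in primes n by rewrite mem_primes => /and3P [-> _ ->].
  rewrite -logn_gt0 lt0n; apply/eqP => E; move: H; rewrite E expn0 exp1n; lia.
have sP0 : 0 < size P.
  by move: sP => /(_ (pdiv n)); rewrite mem_primes n0 pdiv_prime // pdiv_dvd => /(_ isT); case: (P).
have : n ^ size P <= n.-1 ^ size P.
  rewrite {1}(smooth_prod n0 uP sP) (big_morph (expn^~ _) (fun a b => expnMn a b _) (exp1n _)).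
  have -> : n.-1 ^ size P = \prod_(q <- P) n.-1.
    by rewrite big_const_seq count_predT iter_muln_1.
  rewrite !big_seq; apply: leq_prod => q /H; lia.
by rewrite leqNgt ltn_exp2r // prednK // leqnn.
Qed.

(* Take q with the largest power q ^ l in repunit p E; lifting the exponent from
   p ^ (q * (q - 1)), which is 1 modulo q ^ 2, bounds q ^ l by p ^ (q ^ 2) * E. *)
Lemma smooth_repunit_exponent_le P p E : uniq P -> prime p -> 1 < E -> smooth P (repunit p E) ->
  exists q, [/\ q \in P, q %| repunit p E & E <= 2 ^ (16 * size P + 17) * q ^ 2].
Proof.
move=> uP pp E1 sP; set k := size P; have E0 := ltnW E1; have p1 := prime_gt1 pp.
have S1 : 1 < repunit p E.
  case: E E1 {E0 sP} => // -[//|E] _; apply: leq_trans (repunit_geX _ _).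
  by rewrite expnS (leq_trans p1) // leq_pmulr // expn_gt0 (ltnW p1).
have [q [qP qS pq SE]] := smooth_big_part S1 uP sP.
exists q; split=> //; set l := logn q _ in SE; have q1 := prime_gt1 pq.
set x := p ^ (q.-1 * q).
have qp : coprime p (q ^ 2).
  by rewrite coprimeXr // coprime_sym prime_coprime // (prime_dvd_repunit_ndvd E0).
have x1 : x = 1 %[mod q ^ 2].
  by rewrite -(Euler_exp_totient qp) totient_pfactor // expn1.
have x0 : 0 < x by rewrite expn_gt0 (ltnW p1).
have dv : q ^ l %| (x ^ E).-1.
  rewrite /x -expnM mulnC expnM; apply: dvdn_trans (dvdn_pred_predX _ _).
  by apply: dvdn_trans (pfactor_dvdnn _ _) _; rewrite -repunitM dvdn_mull.
have := lifting_exponent pq x0 E0 x1 dv.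
have xgt : 1 < x by rewrite -[1](expn0 p) ltn_exp2l // muln_gt0 (ltnW q1); case: (q) q1 => // -[].
move=> /dvdn_leq; rewrite muln_gt0 E0 andbT -subn1 subn_gt0 => /(_ xgt) qlE.
have qlE' : q ^ l <= p ^ (q ^ 2) * E.
  apply: (leq_trans qlE); rewrite leq_mul2r; apply/orP; right.
  apply: (leq_trans (leq_subr _ _)); rewrite leq_exp2l //.
  by rewrite expnS expn1 leq_mul2r leq_pred orbT.
rewrite leqNgt; apply/negP => big.
have k0 : 0 < k by rewrite /k; case: (P) qP.
set z := (trunc_log 2 E).+1.
have /andP [Ez1 Ez2] := trunc_log_bounds (ltnSn 1) E0.
(* Comparing sizes leaves E - 1 <= k q^2 + k z, with z about log E; a large E contradicts this. *)
have main : p ^ E.-1 <= p ^ (k * q ^ 2 + z * k).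
  apply: (@leq_trans (repunit p E)); first by rewrite -{2}(prednK E0) repunit_geX.
  apply: (leq_trans SE); rewrite -/k; apply: (@leq_trans ((p ^ (q ^ 2) * E) ^ k)).
    by rewrite leq_exp2r.
  rewrite expnMn -expnM expnD mulnC [k * _]mulnC mulnC leq_mul2l; apply/orP; right.
  rewrite [in leqRHS]expnM leq_exp2r // (leq_trans (ltnW Ez2)) // leq_exp2r //.
rewrite leq_exp2l // in main.
have q4 : 0 < q ^ 2 by rewrite expn_gt0 (ltnW q1).
(* This takes z past the threshold 4 (4k + 4) of [exp_dominates_poly], which makes k z less than E /
   2. *)
have zbig : 16 * k + 17 < z.
  rewrite -(ltn_exp2l _ _ (ltnSn 1)); apply: ltn_trans Ez2; apply: leq_ltn_trans big.
  by rewrite leq_pmulr.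
have := @exp_dominates_poly 1 (4 * k + 4) z isT; rewrite expn1 => H.
have {}H : (4 * k + 4) * z <= 2 * E.
  apply: (leq_trans (H _)); first by lia.
  by rewrite /z expnS leq_mul2l Ez1.
have : 2 * k + 2 <= 2 ^ (16 * k + 17).
  by apply: (@leq_trans (16 * k + 17)); [lia | apply/ltnW/ltn_expl].
move: big main H q4; rewrite -/k; set y := 2 ^ (16 * k + 17); set Q := q ^ 2; clear; nia.
Qed.

(** By [repunit_inj], p is determined by E p and the valuations of [repunit p (E p)] at P, which are
    at most Z y. *)
Lemma count_small_exponents P (A : seq nat) (E : nat -> nat) y Z : uniq P -> uniq A ->
  (forall p, p \in A -> [/\ prime p, p <= 2 ^ y, 1 < E p <= Z & smooth P (repunit p (E p))]) ->
  size A <= Z.+1 * (Z * y).+1 ^ size P.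
Proof.
move=> uP uA HA.
pose f p : 'I_Z.+1 * {ffun 'I_(size P) -> 'I_(Z * y).+1} :=
  (inord (E p), [ffun i => inord (logn (tnth (in_tuple P) i) (repunit p (E p)))]).
have lgb p q : p \in A -> logn q (repunit p (E p)) < (Z * y).+1.
  move=> /HA [pp py /andP [E1 EZ] _]; have [pq|npq] := boolP (prime q); last first.
    by rewrite lognE (negPf npq).
  have S0 := @repunit_gt0 p _ (ltnW E1).
  rewrite ltnS -(leq_exp2l _ _ (ltnSn 1)).
  apply: (@leq_trans (q ^ logn q (repunit p (E p)))).
    have [->|l0] := posnP (logn q (repunit p (E p))); first by rewrite !expn0.
    by rewrite leq_exp2r // prime_gt1.
  apply: (leq_trans (dvdn_leq S0 (pfactor_dvdnn _ _))).
  apply: (leq_trans (ltnW (repunit_ltX _ (prime_gt1 pp)))).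
  apply: (@leq_trans ((2 ^ y) ^ E p)); first by rewrite leq_exp2r // ltnW.
  by rewrite -expnM leq_exp2l // mulnC leq_mul2r EZ orbT.
have finj : {in A &, injective f}.
  move=> p p' pA p'A [/(congr1 val) /= e1 /ffunP e2].
  have [_ _ /andP [E1 EZ] sm] := HA _ pA; have [_ _ /andP [E1' EZ'] sm'] := HA _ p'A.
  rewrite !inordK // in e1.
  have S0 := @repunit_gt0 p _ (ltnW E1); have S0' := @repunit_gt0 p' _ (ltnW E1').
  apply: (repunit_inj E1); rewrite {2}e1 (smooth_prod S0 uP sm) (smooth_prod S0' uP sm').
  apply: eq_big_seq => q qP; rewrite -index_mem in qP.
  have := e2 (Ordinal qP); rewrite !ffunE => /(congr1 val) /=.
  by rewrite !inordK ?lgb // (tnth_nth 0) /= nth_index -?index_mem // => ->.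
have := max_card (mem (map f A)); rewrite (card_uniqP _) ?map_inj_in_uniq // size_map.
by rewrite card_prod card_ffun !card_ord.
Qed.

Definition primes_upto X Y := [seq p <- primes X | p <= Y].

(** Equivalently, the n-th prime factor of X is at least n^4 once it reaches Y0; this controls tails
    of the sum of 1/p. *)
Definition sparse X Y0 := forall Y, Y0 <= Y -> size (primes_upto X Y) ^ 4 <= Y.

(** * Gaps in the values of the abundancy ratio *)

Section AbundancyGap.
Local Open Scope ring_scope.

(** The inverse of p / (p - 1), the supremum of sigma(p^e) / p^e over e. Its product over the primes
    of n is phi(n) / n. *)
Definition defect (p : nat) : rat := 1 - p%:R^-1.

Lemma defect_ge0 p : 0 <= defect p.
Proof.
rewrite /defect subr_ge0; case: p => [|p]; first by rewrite invr0.
by rewrite invf_le1 ?ltr0n // ler1n.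
Qed.

Lemma defect_le1 p : defect p <= 1.
Proof. by rewrite /defect gerBl invr_ge0. Qed.

Lemma defectE p : (0 < p)%N -> p%:R * defect p = p.-1%:R.
Proof.
by case: p => // p _; rewrite /defect mulrBr mulr1 divff ?pnatr_eq0 // -natr1 addrK.
Qed.

(** The i-th factor is at least 1 - 1 / (w i^2), and 1 / i^2 <= 2 (1 / i - 1 / (i + 1)) telescopes;
    the induction carries the partial sum. *)
Lemma prod_defect_quadratic (s : seq nat) w : (0 < w)%N ->
  (forall i, (i < size s)%N -> (w * i.+1 ^ 2 <= nth 0 s i)%N) ->
  1 - 2 / w%:R <= \prod_(p <- s) defect p.
Proof.
move=> w0 H; have wR : 0 < w%:R :> rat by rewrite ltr0n.
have wV : 0 < w%:R^-1 :> rat by rewrite invr_gt0.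
rewrite (big_nth 0%N) big_mkord.
suff C n : (n <= size s)%N ->
   1 - 2 / w%:R * (1 - n.+1%:R^-1) <= \prod_(i < n) defect (nth 0%N s i).
  apply: le_trans (C _ (leqnn _)).
  have := invr_ge0 ((size s).+1%:R : rat); rewrite ler0n => h.
  by rewrite lerB // ger_pMr ?divr_gt0 // gerBl.
elim: n => [|n IH] ns; first by rewrite big_ord0 invr1 subrr mulr0 subr0.
rewrite big_ord_recr /=; have {}IH := IH (ltnW ns).
set P := \prod_(_ < n) _ in IH *; set p := nth 0%N s n.
have pn : (w * n.+1 ^ 2 <= p)%N by apply: H.
have p0 : (0 < p)%N by apply: leq_trans pn; rewrite muln_gt0 w0 expn_gt0.
set a := 2 / w%:R * (1 - n.+1%:R^-1) in IH *.
have N1 : 0 < n.+1%:R :> rat by rewrite ltr0n.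
have N2 : 0 < n.+2%:R :> rat by rewrite ltr0n.
have a0 : 0 <= a by rewrite mulr_ge0 ?divr_ge0 // subr_ge0 invf_le1 // ler1n.
have pe : p%:R^-1 <= w%:R^-1 * (n.+1%:R^-1 * n.+1%:R^-1) :> rat.
  rewrite -!invfM lef_pV2 ?posrE ?mulr_gt0 ?ltr0n // -!natrM ler_nat.
  by apply: leq_trans pn; rewrite expnS expn1.
have p0' : 0 <= p%:R^-1 :> rat by rewrite invr_ge0.
have T : n.+1%:R^-1 * n.+1%:R^-1 <= 2 * (n.+1%:R^-1 - n.+2%:R^-1) :> rat.
  have hx : n.+2%:R = n.+1%:R + 1 :> rat by rewrite natr1.
  have x1 : 1 <= n.+1%:R :> rat by rewrite ler1n.
  rewrite hx; set x := n.+1%:R in N1 x1 *.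
  have -> : 2 * (x^-1 - (x + 1)^-1) = x^-1 * (2 / (x + 1)).
    by field; apply/andP; split; lra.
  rewrite ler_pM2l ?invr_gt0 // ler_pdivlMr; last lra.
  by rewrite mulrC ler_pdivrMr //; lra.
apply: (@le_trans _ _ ((1 - a) * (1 - p%:R^-1))); last first.
  by rewrite /defect ler_wpM2r //; exact: defect_ge0.
have -> : 2 / w%:R * (1 - n.+2%:R^-1) = a + w%:R^-1 * (2 * (n.+1%:R^-1 - n.+2%:R^-1)).
  by rewrite /a; ring.
have : p%:R^-1 <= w%:R^-1 * (2 * (n.+1%:R^-1 - n.+2%:R^-1)) :> rat.
  by apply: (le_trans pe); rewrite ler_pM2l.
set q := p%:R^-1 in p0' *; set v := w%:R^-1 * _.
by have := mulr_ge0 a0 p0'; lra.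
Qed.

(** The i-th entry p satisfies w^2 <= p and, by sparsity, i^4 <= p; the geometric mean gives w i^2
    <= p. *)
Lemma prod_defect_tail X Y0 w (s : seq nat) : sparse X Y0 -> (0 < w)%N -> (Y0 <= w ^ 2)%N ->
  subseq s (primes X) -> all (fun p => w ^ 2 <= p)%N s ->
  1 - 2 / w%:R <= \prod_(p <- s) defect p.
Proof.
move=> sp w0 Yw sX /allP ws; apply: prod_defect_quadratic => // i il.
set p := nth 0%N s i; have ps : p \in s by apply: mem_nth.
have so : sorted ltn s by apply: (subseq_sorted ltn_trans sX); apply: sorted_primes.
have wp := ws _ ps.
have cnt : (i.+1 <= size (primes_upto X p))%N.
  have sz : size (take i.+1 s) = i.+1 by rewrite size_takel.
  rewrite -{1}sz; apply: uniq_leq_size.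
    by rewrite take_uniq // (subseq_uniq sX) ?primes_uniq.
  move=> q /(nthP 0%N) [j]; rewrite sz => ji; rewrite nth_take // => <-.
  have js : (j < size s)%N by apply: leq_trans ji il.
  rewrite mem_filter (mem_subseq sX) ?mem_nth // andbT.
  move: ji; rewrite /p ltnS leq_eqVlt => /orP [/eqP -> //|lt].
  by apply: ltnW; apply: (sorted_ltn_nth ltn_trans 0%N so) => //; rewrite inE.
have := sp p (leq_trans Yw wp) => H.
rewrite -(@leq_exp2r _ _ 2) // expnMn -expnM (expnS p) expn1.
apply: leq_mul => //; apply: leq_trans H; rewrite leq_exp2r //.
Qed.

(** Over all integers from 2 to n the product telescopes to 1 / n, and omitting factors only
    increases it. *)
Lemma prod_defect_all (s : seq nat) n : uniq s -> all (fun p => 1 < p)%N s -> (0 < n)%N ->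
  all (fun p => p <= n)%N s -> n%:R^-1 <= \prod_(p <- s) defect p.
Proof.
move=> us /allP s1 n0 /allP sn.
have -> : \prod_(p <- s) defect p = \prod_(0 <= m < n.+1 | m \in s) defect m.
  rewrite -[RHS]big_filter; apply/perm_big/uniq_perm; rewrite ?filter_uniq ?iota_uniq //.
  move=> p; rewrite mem_filter mem_index_iota /=; case: (boolP (p \in s)) => // /sn.
  by rewrite ltnS => ->.
apply: (@le_trans _ _ (\prod_(0 <= m < n.+1) (if (1 < m)%N then defect m else 1))).
  case: n n0 {sn} => // n _; elim: n => [|n IH].
    by rewrite !big_nat_recr //= big_geq // !mulr1 invr1.
  rewrite big_nat_recr //=; apply: le_trans (ler_wpM2r (defect_ge0 _) IH).
  have n1 : n.+1%:R != 0 :> rat by rewrite pnatr_eq0.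
  have n2 : n.+2%:R != 0 :> rat by rewrite pnatr_eq0.
  rewrite -(mulKf n2 (defect _)) defectE //= mulrCA mulVf // mulr1.
  exact: lexx.
rewrite [leRHS]big_mkcond; apply: ler_prod => m _.
case: ifP => m1; case: ifP => ms; rewrite ?defect_ge0 ?defect_le1 ?ler01 ?lexx //.
by move: (s1 m ms); rewrite m1.
Qed.

Lemma sigma_ge n : (n <= sigma n)%N.
Proof.
case: (posnP n) => [->//|n0]; rewrite sigmaE // -{1}(prod_primes n0).
by apply: leq_prod => p _; apply: repunit_geX.
Qed.

Lemma sigma_gt n : (1 < n)%N -> (n < sigma n)%N.
Proof.
move=> n1; have n0 := ltnW n1; rewrite /sigma (bigD1_seq n) ?divisors_uniq ?divisors_id //=.
rewrite big_mkcond (bigD1_seq 1%N) ?divisors_uniq //=; last by rewrite -dvdn_divisors // dvd1n.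
by rewrite neq_ltn n1 addnA addn1 leq_addr.
Qed.

Lemma repunit_defect_le p e : (0 < p)%N -> (repunit p e.+1)%:R * defect p <= (p ^ e)%:R.
Proof.
move=> p0; have pR : 0 < p%:R :> rat by rewrite ltr0n.
rewrite -(ler_pM2l pR) mulrCA defectE // -!natrM ler_nat mulnC repunitM expnS; lia.
Qed.

(** Each ratio of factors is 1 - p^(- e - 1) >= 1 - 1 / C, and Bernoulli's inequality combines them:
    large powers come close to the limit p / (p - 1). *)
Lemma prod_repunit_lower (s : seq nat) (e : nat -> nat) C : (0 < C)%N ->
  (forall p, p \in s -> (1 < p)%N /\ (C <= repunit p (e p).+1)%N) ->
  (\prod_(p <- s) (p ^ e p * p))%:R * (1 - (size s)%:R / C%:R) <=
  (\prod_(p <- s) (repunit p (e p).+1 * p.-1))%:R :> rat.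
Proof.
move=> C0; have CR : 0 < C%:R :> rat by rewrite ltr0n.
elim: s => [|p s IH] H; first by rewrite !big_nil mul0r subr0 mulr1.
rewrite !big_cons (natrM _ (p ^ e p * p)) (natrM _ (repunit _ _ * _)) /=.
have [p1 Cp] := H p (mem_head _ _).
have {}IH := IH (fun q qs => H q (mem_behead (s := p :: s) qs)).
set m := size s in IH *; set Q := (\prod_(q <- s) _)%:R in IH *;
  set T := (\prod_(q <- s) _)%:R in IH *.
have Q0 : 0 <= Q by apply: ler0n.
have C1 : C%:R^-1 <= 1 :> rat by rewrite invf_le1 // ler1n.
have Ci : 0 < C%:R^-1 :> rat by rewrite invr_gt0.
have step : (p ^ e p * p)%:R * (1 - C%:R^-1) <= (repunit p (e p).+1 * p.-1)%:R :> rat.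
  rewrite mulnC [(_ * p.-1)%N]mulnC repunitM -expnS.
  have Cle : (C <= p ^ (e p).+1)%N by apply: (leq_trans Cp); apply/ltnW/repunit_ltX.
  have x1 : (0 < p ^ (e p).+1)%N by apply: leq_trans Cle.
  rewrite -subn1 natrB // mulrBr mulr1 lerD2l lerN2 ler_pdivlMr // mul1r.
  by rewrite ler_nat.
apply: (@le_trans _ _ ((p ^ e p * p)%:R * (1 - C%:R^-1) * T)); last first.
  by apply: ler_wpM2r => //; apply: ler0n.
apply: (@le_trans _ _ ((p ^ e p * p)%:R * (1 - C%:R^-1) * (Q * (1 - m%:R / C%:R)))); last first.
  by apply: ler_wpM2l => //; rewrite mulr_ge0 // subr_ge0.
rewrite natrM -natr1 -!mulrA; do 2 (apply: ler_wpM2l; first exact: ler0n).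
rewrite mulrCA; apply: ler_wpM2l => //.
have : 0 <= m%:R :> rat by apply: ler0n.
by nra.
Qed.

(** * Comparison of the limiting ratio with ab *)

Section Core.
Variables (X Y a b : nat) (s0 J1 J2 : seq nat).
Hypotheses (X0 : (0 < X)%N) (Y0 : (0 < Y)%N) (oX : odd X) (XY1 : (1 < X)%N || (1 < Y)%N).
Hypotheses (sX : sigma X = (a * Y)%N) (sY : sigma Y = (b * X)%N).
Hypothesis split_primes : perm_eq (primes X) (s0 ++ J1 ++ J2).

Let e p := logn p X.
Let r p := repunit p (e p).+1.

Hypothesis cop : forall p, p \in s0 -> coprime (r p) Y.

Lemma split_prod (f : nat -> nat) : (\prod_(p <- primes X) f p =
  \prod_(p <- s0) f p * (\prod_(p <- J1) f p * \prod_(p <- J2) f p))%N.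
Proof. by rewrite (perm_big _ split_primes) !big_cat. Qed.

Lemma small_part_dvd : (\prod_(p <- s0) r p %| a)%N.
Proof.
have := dvdnn (sigma X); rewrite {1}sigmaE // split_prod -/r.
move=> /(dvdn_trans (dvdn_mulr _ (dvdnn _))); rewrite sX Gauss_dvdl //.
rewrite big_seq; apply: (big_ind (fun y => coprime y Y)) => [|y z Hy Hz|p /cop //].
  exact: coprime1n.
by rewrite coprimeMl Hy.
Qed.

(** [A] / [Bq] is sigma(N0) / N0 times the product of p / (p - 1) over J1, where N0 is the part of X
    supported on s0. *)
Let Bq := (\prod_(p <- s0) p ^ e p * \prod_(p <- J1) p.-1)%N.
Let A := (\prod_(p <- s0) r p * \prod_(p <- J1) p)%N.

Lemma mem_small_exceptional p : p \in J1 -> p \in primes X.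
Proof. by move=> pJ; rewrite (perm_mem split_primes) !mem_cat pJ orbT. Qed.

(* Equality would make the odd number prod p over J1 a multiple of prod p.-1, so J1 is empty
   and a = b = 1. *)
Lemma ratio_neq : A != (a * b * Bq)%N.
Proof.
apply/eqP; have /dvdnP [c aE] := small_part_dvd; rewrite /A /Bq aE.
set S0 := (\prod_(p <- s0) r p)%N; set N0 := (\prod_(p <- s0) _)%N.
have S00 : (0 < S0)%N by apply: prodn_gt0 => p; apply: repunit_gt0.
have -> : (c * S0 * b * (N0 * \prod_(p <- J1) p.-1) = S0 * (c * b * N0 * \prod_(p <- J1) p.-1))%N.
  by ring.
move/eqP; rewrite eqn_pmul2l // => /eqP.
case EJ : J1 => [|p J] /=.
  rewrite !big_nil muln1 => /esym/eqP; rewrite !muln_eq1 -andbA => /and3P [/eqP c1 /eqP b1 /eqP N1].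
  have S1 : S0 = 1%N.
    case Es : s0 @S0 @N0 N1 S00 => [|p s] S0 N0; first by rewrite /S0 big_nil.
    have pX : p \in primes X by rewrite (perm_mem split_primes) Es mem_head.
    have pp : prime p by move: pX; rewrite mem_primes => /and3P [].
    move/eqP; rewrite /N0 big_cons muln_eq1 => /andP [/eqP p1 _].
    have : (1 < p ^ e p)%N by rewrite -(expn0 p) ltn_exp2l ?prime_gt1 // /e logn_gt0.
    by rewrite p1.
  have YX : sigma X = Y by rewrite sX aE c1 -/S0 S1 !mul1n.
  have XY : sigma Y = X by rewrite sY b1 mul1n.
  have := sigma_ge X; have := sigma_ge Y; rewrite YX XY => h1 h2.
  have XYE : X = Y by apply/eqP; rewrite eqn_leq h1 h2.
  by case/orP: XY1 => /sigma_gt; rewrite ?YX ?XY XYE ltnn.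
rewrite !big_cons => /(congr1 odd).
have oJ q : q \in J1 -> odd q.
  move=> /mem_small_exceptional; rewrite mem_primes => /and3P [_ _ /dvdn_odd]; exact.
have oJ' : odd (\prod_(q <- J) q)%N.
  rewrite big_seq; apply: (big_ind odd) => // [y z Hy Hz|q qJ]; first by rewrite oddM Hy.
  by apply: oJ; rewrite EJ inE qJ orbT.
have op : odd p by apply: oJ; rewrite EJ mem_head.
by rewrite !oddM op oJ' /= -[odd p.-1]negbK -oddS prednK ?op ?andbF //; case: (p) op.
Qed.

Variables (C K w : nat).
Hypotheses (CJ : forall p, p \in J1 -> (C <= r p)%N) (sJ : (size J1 <= K)%N).
Hypotheses (w0 : (1 < w)%N) (tail2 : 1 - 2 / w%:R <= \prod_(p <- J2) defect p).
Hypothesis (tailY : 1 - 2 / w%:R <= \prod_(p <- primes Y) defect p).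

Lemma prod_defect_ge0 (s : seq nat) : 0 <= \prod_(p <- s) defect p.
Proof. by apply: prodr_ge0 => p _; apply: defect_ge0. Qed.

Lemma sigma_defect_le n : (0 < n)%N -> (sigma n)%:R * \prod_(p <- primes n) defect p <= n%:R.
Proof.
move=> n0; rewrite sigmaE // natr_prod -big_split /= -{3}(prod_primes n0) natr_prod !big_seq.
apply: ler_prod => p; rewrite mem_primes => /and3P [/prime_gt0 p0 _ _].
by rewrite repunit_defect_le // andbT mulr_ge0 ?defect_ge0.
Qed.

(** By [ratio_neq] the integers A and a b Bq differ by at least 1, while sigma(X) sigma(Y) = a b X Y
    forces A / Bq to be too close to a b on either side. *)
Lemma no_small_ratio_gap : (4 * (a * b * Bq) < w)%N -> (K * (a * b * Bq + 1) < C)%N -> False.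
Proof.
set h := (a * b)%N => wb Cb.
pose X0' := (\prod_(p <- s0) p ^ e p)%N; pose X1 := (\prod_(p <- J1) p ^ e p)%N.
pose X2 := (\prod_(p <- J2) p ^ e p)%N.
pose R0 := (\prod_(p <- s0) r p)%N; pose R1 := (\prod_(p <- J1) r p)%N;
  pose R2 := (\prod_(p <- J2) r p)%N.
pose P1 := (\prod_(p <- J1) p)%N; pose Q1 := (\prod_(p <- J1) p.-1)%N.
have XE : X = (X0' * (X1 * X2))%N by rewrite -{1}(prod_primes X0) split_prod.
have SE : sigma X = (R0 * (R1 * R2))%N by rewrite sigmaE // split_prod.
have hE : (h * (X * Y) = sigma X * sigma Y)%N by rewrite sX sY /h; ring.
have pr p : p \in primes X -> (1 < p)%N by rewrite mem_primes => /and3P [/prime_gt1].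
have J2p p : p \in J2 -> (1 < p)%N.
  by move=> pJ; apply: pr; rewrite (perm_mem split_primes) !mem_cat pJ !orbT.
have posX : ((0 < X0') && ((0 < X1) && (0 < X2)))%N by move: X0; rewrite XE !muln_gt0.
have [X0'0 /andP [X10 X20]] := andP posX.
have R20 : (X2 <= R2)%N by apply: leq_prod => p _; apply: repunit_geX.
have R00 : (0 < R0)%N by apply: prodn_gt0 => p; apply: repunit_gt0.
have Q10 : (0 < Q1)%N.
  rewrite /Q1 big_seq; apply: prodn_cond_gt0 => p /mem_small_exceptional /pr; lia.
have := ratio_neq; rewrite neq_ltn -/h => /orP [lt|gt].
(* Case A < a b Bq: the primes of Y and J2 raise the ratio by a factor of at most 1 / (1 - 4 / w),
   too little to make up for the difference. *)
- have c1 : (R1 * Q1 <= X1 * P1)%N.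
    rewrite /R1 /Q1 /X1 /P1 -!big_split /= !big_seq;
      apply: leq_prod => p /mem_small_exceptional /pr p1.
    by rewrite mulnC repunitM -expnSr leq_pred.
  have c2 : R2%:R * \prod_(p <- J2) defect p <= X2%:R.
    rewrite /R2 /X2 !natr_prod -big_split /= !big_seq; apply: ler_prod => p /J2p p1.
    by rewrite repunit_defect_le ?(ltnW p1) // andbT mulr_ge0 ?defect_ge0.
  have c3 := sigma_defect_le Y0.
  have t2 := tail2; have tY := tailY.
  set G2 := \prod_(p <- J2) _ in c2 t2; set GY := \prod_(p <- primes Y) _ in c3 tY.
  have wR : 0 < w%:R :> rat by rewrite ltr0n ltnW.
  have w2 : 2 / w%:R <= 1 :> rat by rewrite ler_pdivrMr // mul1r ler_nat.
  have GG : 1 - 4 / w%:R <= GY * G2.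
    have v0 : 0 < w%:R^-1 :> rat by rewrite invr_gt0.
    apply: (@le_trans _ _ ((1 - 2 / w%:R) * (1 - 2 / w%:R))); last first.
      by apply: ler_pM; rewrite ?subr_ge0.
    by nra.
  have e1 : h%:R * X%:R * GY <= (sigma X)%:R.
    have YR : 0 < Y%:R :> rat by rewrite ltr0n.
    rewrite -(ler_pM2r YR) (_ : _ * _ * _ * _ = (h * (X * Y))%:R * GY); last by rewrite !natrM;
      ring.
    by rewrite hE natrM -mulrA ler_wpM2l ?ler0n.
  have e2 : h%:R * X%:R * GY * (G2 * Q1%:R) <= R0%:R * (X1%:R * P1%:R) * X2%:R.
    apply: (@le_trans _ _ ((sigma X)%:R * (G2 * Q1%:R))).
      by rewrite ler_wpM2r // mulr_ge0 ?ler0n // prod_defect_ge0.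
    rewrite SE !natrM (_ : _ * _ * _ = R0%:R * (R1%:R * Q1%:R) * (R2%:R * G2)); last by ring.
    apply: ler_pM => //; rewrite ?mulr_ge0 ?ler0n ?prod_defect_ge0 //.
    by rewrite ler_wpM2l ?ler0n // -!natrM ler_nat.
  have e3 : (h * Bq)%:R * (GY * G2) <= A%:R.
    have XXR : 0 < (X1 * X2)%:R :> rat by rewrite ltr0n muln_gt0 X10.
    rewrite -(ler_pM2r XXR).
    rewrite (_ : _ * _ * _ = h%:R * X%:R * GY * (G2 * Q1%:R)); last first.
      by rewrite {1}XE /Bq -/X0' -/Q1 !natrM; ring.
    apply: (le_trans e2); rewrite /A -/R0 -/P1 !natrM le_eqVlt; apply/orP; left; apply/eqP; ring.
  have e4 : A%:R <= (h * Bq)%:R - 1 :> rat.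
    by rewrite lerBrDr natr1 ler_nat.
  have hB0 : 0 <= (h * Bq)%:R :> rat by apply: ler0n.
  have : (h * Bq)%:R * (1 - 4 / w%:R) <= (h * Bq)%:R - 1 :> rat.
    by apply: le_trans e4; apply: le_trans e3; apply: ler_wpM2l.
  rewrite mulrBr mulr1 lerD2l lerN2 mulrA ler_pdivlMr // mul1r mulrC.
  by rewrite -natrM ler_nat leqNgt wb.
(* Case A > a b Bq: Y and J2 only raise the ratio, and J1 falls short of its limit by a factor of at
   least 1 - K / C, too little to come down to a b. *)
have C0 : (0 < C)%N by apply: leq_ltn_trans Cb.
have c1 := @prod_repunit_lower J1 e C C0 (fun p pJ =>
  conj (pr p (mem_small_exceptional pJ)) (CJ pJ)).
rewrite !big_split /= -/X1 -/P1 -/R1 -/Q1 in c1.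
have e1 : (R0 * R1 <= h * (X0' * X1))%N.
  have YX : (0 < Y * X2)%N by rewrite muln_gt0 Y0.
  rewrite -(leq_pmul2r YX); apply: (@leq_trans (sigma X * sigma Y)).
    rewrite SE; apply: (@leq_trans (R0 * R1 * (Y * R2))).
      by rewrite leq_mul2l leq_mul2l R20 !orbT.
    by rewrite (_ : R0 * R1 * (Y * R2) = R0 * (R1 * R2) * Y)%N ?leq_mul2l ?sigma_ge ?orbT //; ring.
  by rewrite -hE {1}XE; apply: eq_leq; ring.
have CR : 0 < C%:R :> rat by rewrite ltr0n.
have e2 : A%:R * (1 - (size J1)%:R / C%:R) <= (h * Bq)%:R :> rat.
  have X1R : 0 < X1%:R :> rat by rewrite ltr0n.
  rewrite -(ler_pM2r X1R).
  apply: (@le_trans _ _ (R0%:R * (R1 * Q1)%:R)).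
    rewrite (_ : _ * _ * _ = R0%:R * ((X1 * P1)%:R * (1 - (size J1)%:R / C%:R))); last first.
      by rewrite /A -/R0 -/P1 !natrM; ring.
    by rewrite ler_wpM2l ?ler0n.
  rewrite -!natrM ler_nat mulnA; apply: (@leq_trans (h * (X0' * X1) * Q1)).
    by rewrite leq_mul2r e1 orbT.
  by rewrite /Bq -/X0' -/Q1; apply: eq_leq; ring.
have e3 : (h * Bq + 1)%:R * (1 - K%:R / C%:R) <= (h * Bq)%:R :> rat.
  apply: le_trans e2; have K1 : 0 <= 1 - K%:R / C%:R :> rat.
    rewrite subr_ge0 ler_pdivrMr // mul1r ler_nat; apply: leq_trans (ltnW Cb).
    by rewrite leq_pmulr // addn1.
  apply: ler_pM => //; first by rewrite ler_nat addn1.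
  by rewrite lerD2l lerN2 ler_wpM2r ?invr_ge0 ?ler_nat // ltW.
move: e3; rewrite natrD mulrDl mul1r mulrBr mulr1 -addrA gerDl => e3.
have : C%:R <= (K * (h * Bq + 1))%:R :> rat.
  rewrite -(ler_pM2r (_ : 0 < C%:R^-1)) ?invr_gt0 // mulfV ?gt_eqF //.
  rewrite (natrM _ K) natrD; move: e3; set x := (h * Bq)%:R; set v := C%:R^-1; lra.
by rewrite ler_nat leqNgt Cb.
Qed.
End Core.

End AbundancyGap.

(** * Siegel's lemma and Hermite interpolation *)

Section Interpolation.
Local Open Scope ring_scope.

(** Box principle on vectors with entries in [0, H]. With H = 2 n V each equation takes at most H^2
    + 1 < (H + 1)^2 values, so two unknowns per equation suffice. *)
Lemma siegel (I J : finType) (A : J -> I -> int) (V : nat) :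
  (0 < #|I|)%N -> (0 < V)%N -> (2 * #|J| <= #|I|)%N -> (forall j i, `|A j i| <= V%:Z) ->
  exists x : I -> int, [/\ exists i, x i != 0,
    forall i, `|x i| <= (2 * #|I| * V)%:Z & forall j, \sum_i A j i * x i = 0].
Proof.
move=> I0 V0 IJ AV; set n := #|I| in I0 IJ *; set H := (2 * n * V)%N.
have bnd (c : {ffun I -> 'I_H.+1}) j : `|\sum_i A j i * (c i)%:Z| <= (n * (V * H))%:Z.
  apply: (le_trans (ler_norm_sum _ _ _)).
  have -> : (n * (V * H))%:Z = \sum_(i : I) (V * H)%:Z.
    by rewrite sumr_const -/n -mulr_natl natz PoszM.
  apply: ler_sum => i _; rewrite normrM PoszM ler_pM ?AV //.
  by rewrite lez_nat; have := ltn_ord (c i); lia.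
pose W := (2 * (n * (V * H)))%N.
pose F (c : {ffun I -> 'I_H.+1}) : {ffun J -> 'I_W.+1} :=
  [ffun j => inord `|(\sum_i A j i * (c i)%:Z + (n * (V * H))%:Z)%R|%N].
have [/injectiveP Finj|] := boolP (injectiveb F).
  have := leq_card _ Finj; rewrite !card_ffun !card_ord -/n => le1.
  suff: (W.+1 ^ #|J| < H.+1 ^ n)%N by rewrite ltnNge le1.
  have H0 : (0 < H)%N by rewrite /H !muln_gt0 I0 V0.
  have [->|J0] := posnP #|J|; first by rewrite expn0 -{1}(exp1n n) ltn_exp2r.
  apply: (@leq_trans (H.+1 ^ (2 * #|J|))); last by rewrite leq_pexp2l.
  by rewrite expnM ltn_exp2r // /W; have -> : H = (2 * n * V)%N by []; nia.
move=> /injectivePn [c [d cd Fcd]].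
exists (fun i => (c i)%:Z - (d i)%:Z); split.
- apply/existsP; apply: contraR cd; rewrite negb_exists => /forallP E.
  apply/eqP/ffunP => i; apply/val_inj/eqP; have := E i.
  by rewrite negbK subr_eq0 eqz_nat.
- by move=> i; have := ltn_ord (c i); have := ltn_ord (d i); rewrite -/H; lia.
move=> j; have := congr1 (fun f : {ffun J -> 'I_W.+1} => nat_of_ord (f j)) Fcd.
have := bnd c j; have := bnd d j.
rewrite /F !ffunE; set a := \sum_i _; set b := \sum_i _ => Ha Hb.
rewrite !inordK; [|rewrite /W; lia..] => E.
transitivity (b - a); last by lia.
by rewrite -sumrB; apply: eq_bigr => i _; rewrite mulrBr.
Qed.

(** * Rolle's theorem with multiplicities *)

Section Jets.
Variable R : realType.
Implicit Types (g : nat -> R -> R) (s : nat -> R).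

(** A function is carried together with the explicit family of its successive derivatives. *)
Definition jet g := forall j x, is_derive (x : R) (1 : R) (g j) (g j.+1 x).

(* A zero of multiplicity m is encoded by m consecutive equal nodes. *)
Lemma rolle_jet n : forall g s, jet g ->
  (forall i, (i < n)%N -> s i <= s i.+1) ->
  (forall i k, (i + k <= n)%N -> s i = s (i + k)%N -> g k (s i) = 0) ->
  exists xi, s 0%N <= xi <= s n /\ g n xi = 0.
Proof.
elim: n => [|n IH] g s Hg mono van.
  by exists (s 0%N); rewrite lexx; split=> //; apply: (van 0%N 0%N).
(* Between distinct nodes Rolle's theorem gives a zero strictly inside; at equal nodes the
   multiplicity gives the node itself. Strictness tracks multiplicities below. *)
have step i : (i <= n)%N -> exists t, [/\ s i <= t <= s i.+1, g 1%N t = 0 &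
    s i < s i.+1 -> s i < t < s i.+1].
  move=> ile; have := mono i ile; rewrite le_eqVlt => /orP [/eqP E|lt].
    exists (s i); rewrite lexx -E lexx ltxx; split=> //.
    by apply: van; rewrite addn1.
  have [|||c] := @Rolle R (g 0%N) _ _ lt.
  - by move=> x _; have [] := Hg 0%N x.
  - apply: derivable_within_continuous => x _; by have [] := Hg 0%N x.
  - have := van i 0%N; have := van i.+1 0%N; rewrite !addn0 => H1 H2.
    by rewrite H1 ?H2 // ltnW.
  rewrite in_itv /= => /andP [c1 c2] [_ D].
  exists c; split; first by rewrite !ltW.
    by have [_ <-] := Hg 0%N c.
  by rewrite c1 c2.
have [t Ht] : exists t : nat -> R, forall i, (i <= n)%N ->
    [/\ s i <= t i <= s i.+1, g 1%N (t i) = 0 & s i < s i.+1 -> s i < t i < s i.+1].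
  have : forall i, exists t, (i <= n)%N -> [/\ s i <= t <= s i.+1, g 1%N t = 0 &
    s i < s i.+1 -> s i < t < s i.+1].
    move=> i; case: (leqP i n) => [/step [t Ht]|//]; first by exists t.
    by exists 0.
  by move=> /choice [t Ht]; exists t.
have smono i j : (i <= j)%N -> (j <= n.+1)%N -> s i <= s j.
  elim: j => [|j IHj]; first by rewrite leqn0 => /eqP ->.
  rewrite leq_eqVlt => /orP [/eqP -> //|lt] le.
  by apply: (le_trans (IHj lt (ltnW le))); apply: mono.
have [||xi [xi1 xi2]] := IH (fun j => g j.+1) t (fun j => Hg j.+1).
- move=> i lt; have [/andP [_ H1] _ _] := Ht i (ltnW lt).
  have [/andP [H2 _] _ _] := Ht i.+1 lt; exact: le_trans H1 H2.
- move=> i [|k] le E.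
    by rewrite addn0 in le; have [] := Ht i le.
  have lei : (i <= n)%N by lia.
  have [/andP [A1 A2] _ A3] := Ht i lei; have [/andP [B1 B2] _ B3] := Ht _ le.
  have M : s i.+1 <= s (i + k.+1)%N by apply: smono; lia.
  (* If t i = t (i + k + 1), strictness forces all nodes from s i to s (i + k + 2) to coincide, so
     the required vanishing is one more order of [van]. *)
  have E1 : s i.+1 = t i by apply/le_anti; rewrite A2 andbT E (le_trans M).
  have E2 : s (i + k.+1)%N = t i by apply/le_anti; rewrite -{2}E1 M {1}E B1.
  have E3 : s i = t i.
    apply/eqP; rewrite eq_le A1 /= -E1 leNgt; apply/negP => /A3.
    by rewrite E1 ltxx andbF.
  have E4 : s (i + k.+1).+1 = t i.
    apply/eqP; rewrite eq_le {2}E B2 andbT -E2 leNgt; apply/negP => /B3.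
    by rewrite -E E2 ltxx.
  by rewrite -E3; apply: van; [lia | rewrite E3 -E4 -addnS].
exists xi; split=> //; have [/andP [H1 _] _ _] := Ht 0%N (leq0n n).
have [/andP [_ H2] _ _] := Ht n (leqnn n).
by move: xi1 => /andP [a b]; rewrite (le_trans H1 a) (le_trans b H2).
Qed.

End Jets.

(** * Hermite interpolation at consecutive integers *)

Section Hermite.
Variable R : realType.

Lemma derivnS_XsubC_mul (a : R) (q : {poly R}) j :
  (('X - a%:P) * q)^`(j.+1) = ('X - a%:P) * q^`(j.+1) + q^`(j) *+ j.+1.
Proof.
elim: j => [|j IH].
  by rewrite !derivn1 derivM derivXsubC mul1r addrC derivn0.
rewrite derivnS IH derivD derivM derivXsubC mul1r derivMn -!derivnS.
by rewrite [in RHS]mulrS addrCA addrA.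
Qed.

Lemma derivn_XsubC_exp_mul (a : R) (q : {poly R}) m j : (j <= m)%N ->
  ((('X - a%:P) ^+ m * q)^`(j)).[a] = if j == m then q.[a] *+ m`! else 0.
Proof.
elim: m j => [|m IH] [|j] // le.
- by rewrite expr0 mul1r derivn0.
- by rewrite derivn0 exprS !hornerE subrr !mul0r.
rewrite exprS -mulrA derivnS_XsubC_mul hornerD hornerM !hornerE subrr mul0r add0r.
rewrite hornerMn IH // eqSS; case: eqP => // [->|_]; last by rewrite mul0rn.
by rewrite -mulrnA factS mulnC.
Qed.

(* The nodes are 1, 2, 3, ..., each repeated S times; nodal S t vanishes at the first t. *)
Definition node S (u : nat) : R := (u %/ S).+1%:R.

Definition nodal S t : {poly R} := \prod_(0 <= v < t) ('X - (node S v)%:P).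

Lemma nodalS S t : nodal S t.+1 = ('X - (node S t)%:P) * nodal S t.
Proof. by rewrite /nodal big_nat_recr //= mulrC. Qed.

Lemma size_nodal S t : size (nodal S t) = t.+1.
Proof. by rewrite /nodal size_prod_XsubC size_iota subn0. Qed.

Lemma nodal_split S t u : (0 < S)%N -> (u %/ S * S <= t)%N -> 
  exists q, nodal S t = ('X - (node S u)%:P) ^+ minn (t - u %/ S * S) S * 
     (nodal S (u %/ S * S) * q) /\ ((t <= u %/ S * S + S)%N -> q = 1).
Proof.
move=> S0 le; set l := (u %/ S)%N in le *; set m := minn _ _.
have mt : (l * S + m <= t)%N by rewrite /m; lia.
have mS : (m <= S)%N by rewrite /m; lia.
have nodeE v : (l * S <= v < l * S + m)%N -> node S v = node S u.
  move=> /andP [H1 H2]; rewrite /node; congr (_.+1%:R).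
  have -> : (v = l * S + (v - l * S))%N by lia.
  by rewrite divnMDl // divn_small ?addn0 //; lia.
exists (\prod_(l * S + m <= v < t) ('X - (node S v)%:P)); split; last first.
  by move=> H; rewrite big_geq // /m; lia.
rewrite /nodal (big_cat_nat (n := l * S + m)) //= (big_cat_nat (n := l * S)) ?leq_addr //=.
rewrite [X in _ * X * _](eq_big_nat _ _ (F2 := fun _ => 'X - (node S u)%:P)); last first.
  by move=> v Hv; rewrite nodeE.
by rewrite prodr_const_nat addKn -mulrA mulrCA.
Qed.

Lemma nodal_root S t u : (0 < S)%N -> (u < t)%N ->
  ((nodal S t)^`(u %% S)).[node S u] = 0.
Proof.
move=> S0 lt; have D := divn_eq u S; have M := ltn_pmod u S0.
have [|q [-> _]] := @nodal_split S t u S0; first lia.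
rewrite (_ : minn _ _ = (u %% S).+1 + (minn (t - u %/ S * S) S - (u %% S).+1))%N; last lia.
by rewrite exprD -mulrA derivn_XsubC_exp_mul // ltn_eqF.
Qed.

(** The value is a factorial times a product of nonzero integers. Newton's interpolation divides by
    it without loss. *)
Lemma nodal_diag S u : (0 < S)%N -> 1 <= `|((nodal S u)^`(u %% S)).[node S u]|.
Proof.
move=> S0; have D := divn_eq u S; have M := ltn_pmod u S0.
have [|q [-> q1]] := @nodal_split S u u S0; first lia.
rewrite q1; last lia.
rewrite (_ : minn _ _ = (u %% S))%N; last lia.
rewrite derivn_XsubC_exp_mul // eqxx mulr1 -mulr_natr normrM.
apply: mulr_ege1; last by rewrite ger0_norm ?ler1n ?fact_gt0.
rewrite horner_prod normr_prod.
rewrite big_nat; apply: (big_ind (fun z : R => 1 <= z)) => //.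
  by move=> a b; apply: mulr_ege1.
move=> v /andP [_ lv]; rewrite !hornerE.
have lt : (v %/ S < u %/ S)%N by rewrite ltn_divLR.
rewrite /node -natrB ?normr_nat ?ler1n; lia.
Qed.

(** By Leibniz' rule a further linear factor gives at most x times the same derivative plus j <= N
    times the preceding one. *)
Lemma nodal_bound S t N (x z : R) j :
  0 <= z <= x -> (forall v, (v < t)%N -> node S v <= x) -> (j <= N)%N ->
  `|((nodal S t)^`(j)).[z]| <= (x + N%:R) ^+ t.
Proof.
move=> /andP [z0 zx]; have x0 := le_trans z0 zx.
elim: t j => [|t IH] j nx jN.
  rewrite /nodal big_geq // expr0; case: j {jN} => [|j].
    by rewrite derivn0 hornerE normr1.
  by rewrite derivSn derivC linear0 horner0 normr0.
have {}IH i : (i <= N)%N -> `|((nodal S t)^`(i)).[z]| <= (x + N%:R) ^+ t.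
  by move=> iN; apply: IH => // v vt; apply: nx; apply: ltnW.
have zn : `|z - node S t| <= x.
  have n0 : 0 <= node S t by rewrite ler0n.
  have := nx t (leqnn _); rewrite ler_norml => H; apply/andP; split; lra.
rewrite nodalS exprS; case: j jN => [|j] jN.
  rewrite derivn0 hornerM normrM hornerXsubC; apply: ler_pM => //.
    by apply: (le_trans zn); rewrite lerDl.
  exact: (IH 0%N).
rewrite derivnS_XsubC_mul hornerD hornerM hornerMn hornerXsubC [leRHS]mulrDl.
apply: (le_trans (ler_normD _ _)); apply: lerD.
  by rewrite normrM; apply: ler_pM => //; apply: IH.
rewrite normrMn -[leLHS]mulr_natl.
apply: ler_pM => //; first by rewrite ler_nat.
by apply: IH; apply: ltnW.
Qed.

(** Newton's form: each node adds a multiple c of [nodal S t]. As |c| <= eps (1 + V)^t by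
    [nodal_diag], the bound on H grows by eps (1 + V)^t V. *)
Lemma hermite_interp S x N (y : nat -> R) eps : (0 < S)%N -> 0 <= eps ->
  (forall v, (v < N)%N -> node S v <= x) -> (forall u, `|y u| <= eps) ->
  exists H : {poly R}, [/\ (size H <= N)%N,
    forall u, (u < N)%N -> (H^`(u %% S)).[node S u] = y u &
    forall j z, (j <= N)%N -> 0 <= z <= x ->
      `|(H^`(j)).[z]| <= eps * ((1 + (x + N%:R) ^+ N) ^+ N - 1)].
Proof.
move=> S0 e0 nx ye; set V := (x + N%:R) ^+ N.
have [N0|Npos] := posnP N.
  exists 0; rewrite size_poly0; split=> // [u|j z _ _]; first by rewrite N0.
  by rewrite linear0 horner0 normr0 N0 expr0 subrr mulr0.
have x1 : 1 <= x by apply: le_trans (nx 0%N Npos); rewrite /node div0n.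
suff: forall t, (t <= N)%N -> exists H : {poly R}, [/\ (size H <= t)%N,
    forall u, (u < t)%N -> (H^`(u %% S)).[node S u] = y u &
    forall j z, (j <= N)%N -> 0 <= z <= x -> `|(H^`(j)).[z]| <= eps * ((1 + V) ^+ t - 1)].
  by apply.
have V0 : 0 <= V by rewrite exprn_ge0 // addr_ge0 //; lra.
elim=> [|t IH] tN.
  exists 0; rewrite size_poly0; split=> // j z _ _.
  by rewrite linear0 horner0 normr0 expr0 subrr mulr0.
have [H [sH HE Hb]] := IH (ltnW tN).
pose w := ((nodal S t)^`(t %% S)).[node S t].
pose c := (y t - (H^`(t %% S)).[node S t]) / w.
have w1 : 1 <= `|w| by apply: nodal_diag.
have w0 : w != 0 by rewrite -normr_gt0; lra.
have cb : `|c| <= eps * (1 + V) ^+ t.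
  rewrite /c normrM normfV ler_pdivrMr ?normr_gt0 //.
  have : `|y t - (H^`(t %% S)).[node S t]| <= eps * (1 + V) ^+ t.
    apply: (le_trans (ler_normB _ _)).
    have := ye t; have := Hb (t %% S)%N (node S t); rewrite nx // ler0n.
    move=> /(_ _ isT) H1 H2; apply: (le_trans (lerD H2 (H1 _)));
      last by rewrite mulrBr mulr1 addrCA subrr addr0.
    by apply: (leq_trans (leq_mod _ _)); apply: ltnW.
  move=> /le_trans; apply; rewrite ler_peMr // mulr_ge0 // exprn_ge0 //; lra.
exists (H + c *: nodal S t); split.
- apply: (leq_trans (size_polyD _ _)); rewrite geq_max (leq_trans sH) //=.
  by apply: (leq_trans (size_scale_leq _ _)); rewrite size_nodal.
- move=> u; rewrite ltnS leq_eqVlt derivnD derivnZ hornerD hornerZ => /orP [/eqP ->|lt].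
    by rewrite -/w /c divfK // addrCA subrr addr0.
  by rewrite nodal_root // mulr0 addr0 HE.
move=> j z jN zx; rewrite derivnD derivnZ hornerD hornerZ.
apply: (le_trans (ler_normD _ _)).
have -> : eps * ((1 + V) ^+ t.+1 - 1) = eps * ((1 + V) ^+ t - 1) + eps * (1 + V) ^+ t * V.
  by rewrite exprS; ring.
apply: lerD; first exact: Hb.
rewrite normrM; apply: ler_pM => //.
apply: (le_trans (@nodal_bound S t N x z j zx _ jN)).
  by move=> v vt; apply: nx; apply: ltn_trans vt tN.
by rewrite /V ler_weXn2l ?(ltnW tN) //; have := ler0n R N; lra.
Qed.

(* Subtracting the (small) Hermite interpolant of f makes the approximate zeros exact. *)
Lemma approx_zeros_bound (f : nat -> R -> R) (S m x : nat) (eps Q : R) :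
  jet f -> (0 < S)%N -> (m < x)%N -> 0 <= eps ->
  (forall i j, (0 < i <= m)%N -> (j < S)%N -> `|f j i%:R| <= eps) ->
  (forall xi, 0 <= xi <= x%:R -> `|f (m * S)%N xi| <= Q) ->
  `|f 0%N x%:R| <= Q * x%:R ^+ (m * S) / (m * S)`!%:R +
     eps * (1 + (x%:R + (m * S)%:R) ^+ (m * S)) ^+ (m * S).
Proof.
move=> jf S0 mx e0 fe; set N := (m * S)%N => fQ.
have nlt v : (v < N)%N -> (v %/ S < m)%N by move=> ?; rewrite ltn_divLR.
have nx v : (v < N)%N -> node S v <= x%:R.
  by move=> /nlt H; rewrite /node ler_nat; lia.
pose y u := if (u < N)%N then f (u %% S)%N (node S u) else 0.
have ye u : `|y u| <= eps.
  rewrite /y; case: ifP => [/nlt H|_]; last by rewrite normr0.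
  by apply: fe; rewrite ?ltn_pmod.
have [H [sH HE Hb]] := hermite_interp S0 e0 nx ye.
pose W := nodal S N.
have Wx0 : W.[x%:R] != 0.
  rewrite -normr_gt0 /W /nodal horner_prod normr_prod big_nat.
  apply: prodr_gt0 => v /andP [_ /nlt vm]; rewrite hornerXsubC normr_gt0 subr_eq0.
  by rewrite /node eqr_nat; lia.
(* With this c, P also agrees with f at x, so f - P has N + 1 zeros and its N-th derivative has
   one. *)
pose c := (f 0%N x%:R - H.[x%:R]) / W.[x%:R].
pose P := H + c *: W.
pose g j z := f j z - (P^`(j)).[z].
have jg : jet g.
  move=> j z; rewrite /g derivnS; apply: is_deriveB; exact: jf.
pose s i : R := if (i < N)%N then node S i else x%:R.
have [| |xi [xi01 xi0]] := @rolle_jet R N g s jg.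
- move=> i iN; rewrite /s iN; case: ifP => _; last exact: nx.
  by rewrite /node ler_nat ltnS leq_div2r.
- move=> i k ikN; rewrite /s.
  have [lt|ge] := ltnP (i + k) N.
    rewrite (leq_ltn_trans (leq_addr k i) lt) => /eqP.
    rewrite /node eqr_nat eqSS => /eqP E.
    have Di := divn_eq i S; have Dk := divn_eq (i + k) S.
    have lk := ltn_pmod (i + k) S0.
    have kS : (k < S)%N by lia.
    pose u := (i %/ S * S + k)%N.
    have us : (u %/ S = i %/ S)%N by rewrite /u divnMDl // (divn_small kS) addn0.
    have um : (u %% S = k)%N by rewrite /u modnMDl (modn_small kS).
    have uN : (u < N)%N by rewrite /u; lia.
    have nu : (i %/ S).+1%:R = node S u by rewrite /node us.
    rewrite /g /P derivnD derivnZ hornerD hornerZ nu -um HE // nodal_root // mulr0 addr0.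
    by rewrite /y uN subrr.
  have EN : (i + k = N)%N by apply/eqP; rewrite eqn_leq ikN.
  case: k => [|k] in ikN ge EN *.
    rewrite addn0 in EN; rewrite EN ltnn => _; rewrite /g /P derivn0 hornerD hornerZ.
    by rewrite /c divfK // addrCA subrr addr0 subrr.
  have iN : (i < N)%N by lia.
  rewrite iN => /eqP; rewrite /node eqr_nat => /eqP E; have := nlt i iN; lia.
have xix : 0 <= xi <= x%:R.
  move: xi01; rewrite /s ltnn => /andP [a ->]; rewrite andbT; apply: le_trans a.
  by case: ifP => _; rewrite ?ler0n.
(* H has degree below N and W is monic of degree N, so the N-th derivative of P is the constant c
   N!. *)
have cE : c = f N xi / N`!%:R.
  move/eqP: xi0; rewrite /g subr_eq0 => /eqP ->.
  rewrite /P derivnD derivnZ hornerD hornerZ (derivn_poly0 sH) horner0 add0r.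
  have -> : W^`(N) = (N`!%:R)%:P.
    have sW : size W = N.+1 by apply: size_nodal.
    have lW : W`_N = 1.
      have : W \is monic by apply: monic_prod_XsubC.
      by rewrite monicE lead_coefE sW => /eqP.
    apply/polyP => i; rewrite coef_derivn coefC; case: i => [|i].
      by rewrite addn0 ffactnn lW.
    by rewrite nth_default ?mul0rn // sW; lia.
  by rewrite hornerC mulfK // pnatr_eq0 -lt0n fact_gt0.
have -> : f 0%N x%:R = c * W.[x%:R] + H.[x%:R] by rewrite /c divfK // subrK.
apply: (le_trans (ler_normD _ _)); apply: lerD.
  rewrite normrM cE normrM normfV (ger0_norm (ler0n _ _)) mulrAC.
  rewrite ler_wpM2r ?invr_ge0 ?ler0n //.
  apply: ler_pM => //; first exact: fQ.
  rewrite /W /nodal horner_prod normr_prod -[in leRHS](subn0 N) -prodr_const_nat.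
  rewrite !big_nat; apply: ler_prod => v /andP [_ vN].
  rewrite normr_ge0 hornerXsubC /=; have := nx v vN; have : 0 <= node S v by rewrite ler0n.
  by rewrite ler_norml => *; apply/andP; split; have := ler0n R x; lra.
have := Hb 0%N x%:R; rewrite derivn0 ler0n lexx => /(_ isT isT) H1.
by apply: (le_trans H1); apply: ler_wpM2l => //; rewrite lerBlDr lerDl.
Qed.
End Hermite.

End Interpolation.

(** * Linear forms in logarithms *)

Section Extrapolation_method.
Local Open Scope ring_scope.

(** * Extrapolation of zeros of exponential polynomials *)

Section Extrapolation.
Variable R : realType.

Lemma jet_expR_sum (T : finType) (c w : T -> R) :
  jet (fun j z => \sum_t c t * w t ^+ j * expR (z * w t)).
Proof.
move=> j z; rewrite -!/(\sum_(t <- index_enum T) _).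
elim: (index_enum T) => [|t s IH].
  rewrite big_nil; under [X in is_derive _ _ X]funext do rewrite big_nil.
  exact: is_derive_cst.
rewrite big_cons; under [X in is_derive _ _ X]funext do rewrite big_cons.
have E : is_derive z (1 : R) (expR \o (w t \*: id)) (expR (w t *: z) * (w t *: 1)).
  by apply: is_derive1_comp; apply: is_deriveZ.
have E1 := is_deriveZ (c t * w t ^+ j) E.
have -> : (fun z => c t * w t ^+ j * expR (z * w t) + \sum_(t <- s) c t * w t ^+ j * expR (z * w
  t)) =
   ((c t * w t ^+ j) \*: (expR \o (w t \*: id)) + (fun z =>
     \sum_(t <- s) c t * w t ^+ j * expR (z * w t))).
  by apply: funext => y /=; rewrite /GRing.scale /= [y * _]mulrC.
have E2 := is_deriveD E1 IH.
apply: (is_derive_eq E2).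
by rewrite /GRing.scale /= mulr1 exprSr [z * _]mulrC; congr (_ + _); ring.
Qed.

Lemma le_exprn (x y : R) n : 0 <= x -> x <= y -> x ^+ n <= y ^+ n.
Proof. by move=> x0 xy; apply: lerXn2r => //; rewrite nnegrE // (le_trans x0). Qed.

Lemma dist_exp_le (x y om del : R) j : 0 <= del -> 1 <= om -> `|x| <= om -> `|y| <= om ->
  `|x - y| <= del -> `|x ^+ j - y ^+ j| <= j%:R * om ^+ j * del.
Proof.
move=> d0 o1 xo yo xy; elim: j => [|j IH].
  by rewrite !expr0 subrr normr0 !mul0r.
have -> : x ^+ j.+1 - y ^+ j.+1 = x * (x ^+ j - y ^+ j) + (x - y) * y ^+ j.
  by rewrite !exprS; ring.
apply: (le_trans (ler_normD _ _)); rewrite !normrM.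
have -> : j.+1%:R * om ^+ j.+1 * del = om * (j%:R * om ^+ j * del) + om * (del * om ^+ j).
  by rewrite -natr1 exprS; ring.
apply: lerD; first by apply: ler_pM.
have H : `|x - y| * `|y ^+ j| <= del * om ^+ j.
  by apply: ler_pM => //; rewrite normrX le_exprn.
apply: (le_trans H); rewrite ler_peMl // mulr_ge0 // exprn_ge0 //; lra.
Qed.

Variables (r : nat) (T : finType) (p : T -> int) (al : T -> nat) (w : T -> R).
Variables (D : 'I_r -> T -> int) (th : 'I_r -> R).

(* With D i t = b0 * t_i - b_i * t_0, these sums are, up to a multiple of the linear form,
   the derivatives of order e of sum_t p t * exp (z * w t) at the integers l <= m. *)
Definition vanishing (M m : nat) := forall e : 'I_r -> nat, (forall i, (e i < M)%N) ->
  forall l, (0 < l <= m)%N -> \sum_t p t * \prod_i D i t ^+ e i * (al t ^ l)%:Z = 0.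

Let w0 t := \sum_i (D i t)%:~R * th i.

(* w0 is a combination of the D i, so multiplying by w0 costs one order of vanishing. *)
Lemma vanishing_deriv M m j : vanishing M m -> forall e : 'I_r -> nat,
  (forall i, (e i + j < M)%N) -> forall l, (0 < l <= m)%N ->
  \sum_t (p t * \prod_i D i t ^+ e i)%:~R * w0 t ^+ j * (al t ^ l)%:R = 0 :> R.
Proof.
move=> van; elim: j => [|j IH] e eM l lm.
  have V : \sum_t p t * \prod_i D i t ^+ e i * (al t ^ l)%:Z = 0.
    by apply: van => // i; have := eM i; rewrite addn0.
  rewrite -[RHS]/((0 : int)%:~R) -V raddf_sum; apply: eq_bigr => t _.
  by rewrite expr0 mulr1 /= [in RHS]intrM intrM pmulrn.

transitivity (\sum_i th i * (\sum_t (p t * \prod_k D k t ^+ (e k + (k == i)))%:~R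
     * w0 t ^+ j * (al t ^ l)%:R)); last first.
  apply: big1 => i _; rewrite IH ?mulr0 // => k; have := eM k.
  by case: (k == i); lia.
under eq_bigr => t _.
  rewrite exprS mulrA -mulrA {1}/w0 mulr_sumr mulr_suml; over.
rewrite exchange_big; apply: eq_bigr => i _; rewrite mulr_sumr; apply: eq_bigr => t _.
have -> : \prod_k D k t ^+ (e k + (k == i)) = D i t * \prod_k D k t ^+ e k.
  under eq_bigr do rewrite exprD.
  rewrite big_split /= mulrC; congr (_ * _).
  rewrite (bigD1 i) //= eqxx expr1 big1 ?mulr1 // => k /negPf ->.
  by rewrite expr0.
rewrite !intrM; ring.
Qed.

(* The value at l <= m' is an integer, so it vanishes as soon as it is less than 1. *)
Lemma extrapolate (M m m' : nat) (om del Pm De : R) :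
  (0 < M)%N -> (forall t, expR (w t) = (al t)%:R) ->
  1 <= om -> 0 <= del -> 1 <= De -> 0 <= Pm ->
  (forall t, 0 <= w t <= om) -> (forall t, `|w0 t| <= om) ->
  (forall t, `|w t - w0 t| <= del) -> (forall t, `|(p t)%:~R| <= Pm) ->
  (forall i t, `|(D i t)%:~R| <= De) -> vanishing (2 * M) m ->
  #|T|%:R * Pm * De ^+ (r * M) *
    (om ^+ (m * M) * expR (m'%:R * om) * m'%:R ^+ (m * M) / (m * M)`!%:R +
     M%:R * om ^+ M * del * expR (m%:R * om) * (1 + (m'%:R + (m * M)%:R) ^+ (m * M)) ^+ (m * M)) <
       1 ->
  vanishing M m'.
Proof.
move=> M0 wal o1 d0 De1 P0 wo w0o wd pP DD van main e eM l /andP [l0 lm'].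
have [lm|ml] := leqP l m.
  by apply: van; rewrite ?l0 // => i; have := eM i; lia.
set K := _ * De ^+ _ in main; set N := (m * M)%N in main.
have om0 : 0 <= om by lra.
pose c t : R := (p t * \prod_i D i t ^+ e i)%:~R.
have cb t : `|c t| <= Pm * De ^+ (r * M).
  rewrite /c intrM normrM; apply: ler_pM => //.
  rewrite rmorph_prod normr_prod mulnC exprM -[X in _ ^+ X](card_ord r) -prodr_const.
  apply: ler_prod => i _; rewrite normr_ge0 rmorphXn normrX /=.
  apply: (@le_trans _ _ (De ^+ e i)); last by rewrite ler_weXn2l // ltnW.
  exact: le_exprn.
have K0 : 0 <= K by rewrite !mulr_ge0 // exprn_ge0 //; lra.
have sumb (g : T -> R) B : 0 <= B -> (forall t, `|g t| <= B) -> `|\sum_t c t * g t| <= K * B.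
  move=> B0 gB; apply: (le_trans (ler_norm_sum _ _ _)).
  have -> : K * B = \sum_(t : T) Pm * De ^+ (r * M) * B.
    by rewrite sumr_const -mulr_natl /K !mulrA.
  by apply: ler_sum => t _; rewrite normrM ler_pM.
clearbody K.
pose f j z := \sum_t c t * w t ^+ j * expR (z * w t).
have jf : jet f by apply: jet_expR_sum.
pose S0 : int := \sum_t p t * \prod_i D i t ^+ e i * (al t ^ l)%:Z.
have expw t k : expR (k%:R * w t) = (al t ^ k)%:R.
  by rewrite expRM_natl wal natrX.
have f0 : f 0%N l%:R = S0%:~R.
  rewrite /f /S0 raddf_sum; apply: eq_bigr => t _.
  by rewrite expr0 mulr1 expw /= [in RHS]intrM pmulrn.
have expb t z k : 0 <= z <= k%:R -> `|expR (z * w t)| <= expR (k%:R * om).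
  move=> /andP [z0 zk]; rewrite ger0_norm ?expR_ge0 // ler_expR.
  by have /andP [a b] := wo t; apply: ler_pM.
(* With [w0] in place of [w] the sum vanishes, since e and j add up to orders below 2 * M; hence the
   halving. Replacing [w0] by [w] costs a multiple of del. *)
have E1 : forall i j, (0 < i <= m)%N -> (j < M)%N ->
    `|f j i%:R| <= K * (M%:R * om ^+ M * del * expR (m%:R * om)).
  move=> i j im jM.
  have V := vanishing_deriv van (e := e) (j := j) _ im.
  have {}V : \sum_t c t * w0 t ^+ j * (al t ^ i)%:R = 0.
    by apply: V => k; have := eM k; lia.
  have -> : f j i%:R = \sum_t c t * ((w t ^+ j - w0 t ^+ j) * expR (i%:R * w t)).
    rewrite -[LHS]subr0 -[X in _ - X = _]V /f -sumrB.
    apply: eq_bigr => t _; rewrite expw; ring.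
  apply: sumb => [|t].
    by rewrite !mulr_ge0 ?exprn_ge0 ?expR_ge0.
  rewrite normrM; apply: ler_pM => //; last first.
    by apply: expb; rewrite ler0n ler_nat; case/andP: im.
  apply: (@le_trans _ _ (j%:R * om ^+ j * del)).
    apply: dist_exp_le => //; have /andP [a b] := wo t.
    by rewrite ger0_norm.
  by rewrite ler_wpM2r // ler_pM ?exprn_ge0 ?ler_nat ?(ltnW jM) // ler_weXn2l // ltnW.
have E2 : forall xi, 0 <= xi <= l%:R -> `|f N xi| <= K * (om ^+ N * expR (m'%:R * om)).
  move=> xi /andP [x0 xl]; have -> : f N xi = \sum_t c t * (w t ^+ N * expR (xi * w t)).
    by apply: eq_bigr => t _; rewrite mulrA.
  apply: sumb => [|t]; first by rewrite mulr_ge0 ?exprn_ge0 ?expR_ge0.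
  rewrite normrM; apply: ler_pM => //; last first.
    by apply: expb; rewrite x0 (le_trans xl) // ler_nat.
  have /andP [a b] := wo t.
  by rewrite normrX ger0_norm // le_exprn.
have eps0 : 0 <= K * (M%:R * om ^+ M * del * expR (m%:R * om)).
  by rewrite !mulr_ge0 ?exprn_ge0 ?expR_ge0.
have := approx_zeros_bound jf M0 ml eps0 E1 E2; rewrite -/N f0 => bound.
have small : `|S0%:~R : R| < 1.
  apply: (le_lt_trans bound); apply: (le_lt_trans _ main); rewrite mulrDr -!mulrA.
  have lm'R : (l%:R : R) <= m'%:R by rewrite ler_nat.
  apply: lerD.
    rewrite ler_wpM2l // ler_wpM2l ?exprn_ge0 // ler_wpM2l ?expR_ge0 //.
    by rewrite ler_wpM2r ?invr_ge0 // le_exprn.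
  rewrite ler_wpM2l // ler_wpM2l // ler_wpM2l ?exprn_ge0 // ler_wpM2l // ler_wpM2l ?expR_ge0 //.
  have H : 0 <= (l%:R + N%:R : R) ^+ N by rewrite exprn_ge0 // addr_ge0.
  have H' : (l%:R + N%:R : R) ^+ N <= (m'%:R + N%:R) ^+ N.
    by rewrite le_exprn ?addr_ge0 // lerD2r.
  by apply: le_exprn; lra.
apply/eqP; rewrite -[_ == 0]/(S0 == 0) -normr_eq0.
have : `|S0| < 1.
  by rewrite -(ltr_int R) intr_norm.
have : 0 <= `|S0| by []. by lia.
Qed.

End Extrapolation.

(** n^n <= (n + 1) ... (2n) = binomial(2n, n) n!, and the binomial coefficient is at most 4^n. *)
Lemma expnn_le_fact n : (n ^ n <= 4 ^ n * n`!)%N.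
Proof.
case: n => // n; set m := n.+1.
have H k : (m ^ k <= (m + k) ^_ k)%N.
  elim: k => // k IH; rewrite expnS addnS ffactnS.
  by apply: leq_mul => //; lia.
apply: (leq_trans (H m)); rewrite -bin_ffact leq_mul2r; apply/orP; right.
rewrite (_ : 4 = 2 ^ 2)%N // -expnM mul2n -addnn.
have -> : (2 ^ (m + m) = (1 + 1) ^ (m + m))%N by [].
rewrite expnDn (bigD1 (inord m)) //= inordK; last lia.
by rewrite !exp1n !muln1 leq_addr.
Qed.

(** * From sufficient vanishing to zero coefficients *)

Section Core.
Variable R : realType.

(** Linearity in the monomials; Q has no constant term because l starts at 1. *)
Lemma vanishing_poly (r : nat) (T : finType) (p : T -> int) (al : T -> nat)
    (D : 'I_r -> T -> int) (M m : nat) (Q : {poly int}) (g : 'I_r -> {poly int}) :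
  vanishing p al D M m -> (size Q <= m.+1)%N -> Q`_0 = 0 ->
  (forall i, (size (g i) <= M)%N) ->
  \sum_t p t * (\prod_i (g i).[D i t]) * Q.[(al t)%:Z] = 0.
Proof.
move=> van sQ Q0 sg.
transitivity (\sum_(l < m.+1) Q`_l * \sum_(f : {ffun 'I_r -> 'I_M}) (\prod_i (g i)`_(f i)) *
   (\sum_t p t * \prod_i D i t ^+ f i * (al t ^ l)%:Z)).
  transitivity (\sum_(l < m.+1) \sum_(f : {ffun 'I_r -> 'I_M}) \sum_t
     Q`_l * ((\prod_i (g i)`_(f i)) * (p t * \prod_i D i t ^+ f i * (al t ^ l)%:Z))).
    under [RHS]eq_bigr do rewrite exchange_big /=.
    rewrite [RHS]exchange_big /=; apply: eq_bigr => t _.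
    rewrite (horner_coef_wide _ sQ) mulr_sumr; apply: eq_bigr => l _.
    have -> : \prod_i (g i).[D i t] = \prod_i \sum_(j < M) (g i)`_j * D i t ^+ j.
      by apply: eq_bigr => i _; rewrite (horner_coef_wide _ (sg i)).
    rewrite bigA_distr_bigA mulr_sumr mulr_suml; apply: eq_bigr => f _.
    have -> : (al t ^ l)%:Z = (al t)%:Z ^+ l by rewrite -natz natrX natz.
    by rewrite big_split /=; ring.
  apply: eq_bigr => l _; rewrite mulr_sumr; apply: eq_bigr => f _.
  by rewrite !mulr_sumr.
apply: big1 => -[[|l] lm] _; first by rewrite Q0 mul0r.
rewrite big1 ?mulr0 // => f _; rewrite van ?mulr0 // => i; exact: ltn_ord.
Qed.

(* The polynomial Q isolates one value of al, as in a Vandermonde determinant, and g isolates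
   one index among those with this value; no multiplicative independence is needed. *)
Lemma vanishing_trivial (r L : nat) (p : 'I_L * {ffun 'I_r -> 'I_L} -> int)
    (al : 'I_L * {ffun 'I_r -> 'I_L} -> nat) (b : 'I_r -> int) (b0 : int) (M m : nat) :
  (forall t, 0 < al t)%N -> (forall t u, al t = al u -> t.1 = u.1) -> b0 != 0 ->
  (L <= M)%N -> (#|{: 'I_L * {ffun 'I_r -> 'I_L}}| <= m)%N ->
  vanishing p al (fun i t => b0 * (t.2 i)%:Z - b i * t.1%:Z) M m -> forall t, p t = 0.
Proof.
move=> al0 alinj b00 LM cm van s.
set D := (fun _ _ => _) in van.
pose Q : {poly int} := 'X * \prod_(u <- rem (al s) (undup (codom al))) ('X - (u%:Z)%:P).
pose g i : {poly int} := \prod_(j <- rem (s.2 i) (enum 'I_L)) ('X - (b0 * j%:Z - b i * s.1%:Z)%:P).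
have ins : al s \in undup (codom al) by rewrite mem_undup codom_f.
have sQ : (size Q <= m.+1)%N.
  rewrite /Q mulrC size_mulX ?monic_neq0 ?monic_prod_XsubC // size_prod_XsubC ltnS.
  rewrite size_rem // prednK; last by case: (undup _) ins.
  by apply: leq_trans cm; rewrite -(size_codom al) size_undup.
have sg i : (size (g i) <= M)%N.
  rewrite size_prod_XsubC size_rem ?mem_enum // size_enum_ord prednK //.
  exact: leq_ltn_trans (ltn_ord (s.2 i)).
have Q0 : Q`_0 = 0 by rewrite coefXM.
have := vanishing_poly van sQ Q0 sg.
rewrite (bigD1 s) //= [X in _ + X]big1 => [|t ts].
  rewrite addr0 => /eqP; rewrite !mulf_eq0 => /orP [/orP [/eqP //|/prodf_eq0 [i _]]|].
    rewrite horner_prod prodf_seq_eq0 => /hasP [j]; rewrite rem_filter ?enum_uniq //.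
    rewrite mem_filter /= => /andP [ji _]; rewrite hornerXsubC subr_eq0 /D.
    rewrite (inj_eq (addIr _)) (inj_eq (mulfI b00)) eqz_nat => /eqP E.
    by case/eqP: ji; apply/val_inj; rewrite /= E.
  rewrite /Q hornerM hornerX mulf_eq0 horner_prod => /orP [|].
    by rewrite eqz_nat; have := al0 s; case: (al s).
  rewrite prodf_seq_eq0 => /hasP [u]; rewrite rem_filter ?undup_uniq //.
  rewrite mem_filter /= => /andP [us _]; rewrite hornerXsubC subr_eq0 eqz_nat eq_sym.
  by rewrite (negPf us).
have [E|ne'] := eqVneq (al t) (al s); last first.
  rewrite /Q hornerM horner_prod (bigD1_seq (al t)) /= ?rem_uniq ?undup_uniq //.
    by rewrite hornerXsubC subrr mul0r !mulr0.
  by rewrite rem_filter ?undup_uniq // mem_filter /= ne' mem_undup codom_f.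
have E1 := alinj _ _ E.
have [i ti] : exists i, t.2 i != s.2 i.
  apply/existsP; apply: contraR ts; rewrite negb_exists => /forallP H.
  apply/eqP; rewrite [t]surjective_pairing [s]surjective_pairing E1; congr (_, _).
  by apply/ffunP => i; apply/eqP; have := H i; rewrite negbK.
rewrite [X in _ * X * _](bigD1 i) //= /g horner_prod (bigD1_seq (t.2 i)) /= ?rem_uniq ?enum_uniq //.
  by rewrite hornerXsubC /D E1 subrr !(mul0r, mulr0).
by rewrite rem_filter ?enum_uniq // mem_filter /= ti mem_enum.
Qed.
End Core.

Section ExpBounds.
Variable R : realType.

Lemma expR1_le4 : expR 1 <= 4 :> R.
Proof.
have H : expR (2^-1) <= 2 :> R.
  have := expR_ge1Dx (- 2^-1 : R); rewrite expRN => H.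
  have e0 := expR_gt0 (2^-1 : R).
  have : (expR (2^-1))^-1 * expR (2^-1) = 1 :> R by rewrite mulVf // gt_eqF.
  nra.
have -> : expR 1 = expR (2^-1) ^+ 2 :> R by rewrite -expRM_natl; congr expR; lra.
have e0 := expR_gt0 (2^-1 : R); rewrite expr2; nra.
Qed.

Lemma expR_nat_le n : expR n%:R <= (2 ^ (2 * n))%:R :> R.
Proof.
rewrite -[n%:R]mulr1 expRM_natl expnM natrX; apply: le_exprn; rewrite ?expR_ge0 //.
exact: expR1_le4.
Qed.

Lemma ln_nat_le a x : (0 < a)%N -> (a <= 2 ^ x)%N -> 0 <= ln (a%:R : R) <= x%:R.
Proof.
move=> a0 ax; rewrite ln_ge0 ?ler1n //=.
have l2 : ln 2 <= 1 :> R by have := @le_ln1Dx R 1; rewrite (_ : 1 + 1 = 2) //; apply; lra.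
apply: (@le_trans _ _ (ln ((2 ^ x)%:R : R))).
  by rewrite ler_ln ?posrE ?ltr0n ?expn_gt0 // ler_nat.
by rewrite natrX lnXn // -[leLHS]mulr_natl ler_piMr.
Qed.

(** Both terms of [extrapolate] are made at most 1/4. With N = m M the coefficients cost 2^(4N), the
    exponential 2^N, and 256 om m' <= N gains 2^(6N) against N!; in the other term 2^-U beats all
    powers of N up to the cube. *)
Lemma extrapolate_nat (r : nat) (T : finType) (p : T -> int) (al : T -> nat) (w : T -> R)
    (D : 'I_r -> T -> int) (th : 'I_r -> R) (M m m' om d P t U : nat) :
  (0 < M)%N -> (0 < om)%N -> (0 < m <= m')%N -> (forall t, expR (w t) = (al t)%:R) ->
  (forall t, 0 <= w t <= om%:R) -> (forall t, `|\sum_i (D i t)%:~R * th i| <= om%:R) ->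
  (forall t, `|w t - \sum_i (D i t)%:~R * th i| <= (2 ^+ U)^-1) ->
  (forall t, `|(p t)%:~R| <= (2 ^ P)%:R :> R) ->
  (forall i t, `|(D i t)%:~R| <= (2 ^ d)%:R :> R) ->
  (#|T| <= 2 ^ t)%N ->
  (256 * (om * m') <= m * M)%N -> (t + P + d * (r * M) <= 4 * (m * M))%N ->
  (10 * (m * M) ^ 3 + 2 <= U)%N ->
  vanishing p al D (2 * M) m -> vanishing p al D M m'.
Proof.
move=> M0 om0 /andP [m0 mm'] wal wo w0o wd pP DD Tt c1 c2 c3 van.
apply: (extrapolate M0 wal _ _ _ _ wo w0o wd pP DD van).
- by rewrite ler1n.
- by rewrite invr_ge0 exprn_ge0.
- by rewrite ler1n expn_gt0.
- by rewrite ler0n.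
set N := (m * M)%N in c1 c2 c3 *.
have m'0 : (0 < m')%N by lia.
have om_m' : (om * m' <= N)%N by lia.
have N256 : (256 <= N)%N by apply: leq_trans c1; rewrite leq_pmulr // muln_gt0 om0.
have N0 : (0 < N)%N by apply: leq_trans N256.
have m'N : (m' <= N)%N by apply: leq_trans om_m'; rewrite leq_pmull.
have omN : (om <= N)%N by apply: leq_trans om_m'; rewrite leq_pmulr.
have MN : (M <= N)%N by rewrite /N leq_pmull.
set K := _ * _ ^+ (r * M).
have K0 : 0 <= K by rewrite /K !mulr_ge0 // ?exprn_ge0.
have KN : K <= (2 ^ (4 * N))%:R.
  rewrite /K -natrX -!natrM ler_nat.
  apply: (@leq_trans (2 ^ t * 2 ^ P * (2 ^ d) ^ (r * M))); first by rewrite !leq_mul2r Tt !orbT.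
  by rewrite -expnM -!expnD leq_exp2l.
have expom k : (k <= m')%N -> expR (k%:R * om%:R) <= (2 ^ N)%:R :> R.
  move=> km; rewrite -natrM; apply: (le_trans (expR_nat_le _)).
  by rewrite ler_nat leq_exp2l //; nia.
have A1 : om%:R ^+ N * expR (m'%:R * om%:R) * m'%:R ^+ N / N`!%:R <= (2 ^ N)%:R / (2 ^ (6 * N))%:R
  :> R.
  have F : (om ^ N * m' ^ N * 2 ^ (6 * N) <= N`!)%N.
    have H : (256 ^ N * (om * m') ^ N <= 4 ^ N * N`!)%N.
      by apply: leq_trans (expnn_le_fact N); rewrite -expnMn leq_exp2r //; lia.
    have E : (256 ^ N = 4 ^ N * 2 ^ (6 * N))%N by rewrite [RHS]mulnC expnM -expnMn.
    rewrite -(@leq_pmul2l (4 ^ N)) ?expn_gt0 //; apply: leq_trans H.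
    by rewrite E expnMn -[in leqRHS]mulnA (mulnC (2 ^ (6 * N)))%N.
  have FR : om%:R ^+ N * m'%:R ^+ N * (2 ^ (6 * N))%:R <= N`!%:R :> R.
    by rewrite -!natrX -!natrM ler_nat.
  rewrite ler_pdivrMr ?ltr0n ?fact_gt0 // [leRHS]mulrAC ler_pdivlMr ?ltr0n ?expn_gt0 //.
  rewrite (_ : _ * _ * _ * _ = expR (m'%:R * om%:R) * (om%:R ^+ N * m'%:R ^+ N * (2 ^ (6 *
    N))%:R)); last by ring.
  by apply: ler_pM; rewrite ?expR_ge0 ?mulr_ge0 ?exprn_ge0 ?expom.
have A2 : M%:R * om%:R ^+ M * (2 ^+ U)^-1 * expR (m%:R * om%:R) *
   (1 + (m'%:R + N%:R) ^+ N) ^+ N <= (2 ^ (N + N ^ 2 + N + 2 * N ^ 3))%:R / 2 ^+ U :> R.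
  have H1 : (1 + (m'%:R + N%:R) ^+ N) ^+ N <= (2 ^ (2 * N ^ 3))%:R :> R.
    rewrite -natrD -natrX -[1]/(1%:R) -natrD -natrX ler_nat.
    have -> : (2 * N ^ 3 = (2 * N * N) * N)%N by rewrite !expnS expn0; lia.
    rewrite [in leqRHS]expnM leq_exp2r //.
    have H : ((m' + N) ^ N < (2 ^ (m' + N)) ^ N)%N by rewrite ltn_exp2r // ltn_expl.
    rewrite add1n (leq_trans H) // -expnM leq_exp2l // leq_mul2r; apply/orP; right.
    by rewrite mul2n -addnn leq_add2r.
  have H2 : (M%:R * om%:R ^+ M) * expR (m%:R * om%:R) <= (2 ^ (N + N ^ 2 + N))%:R :> R.
    rewrite expnD natrM; apply: ler_pM; rewrite ?mulr_ge0 ?exprn_ge0 ?expR_ge0 ?expom //.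
    rewrite -natrX -natrM ler_nat expnD; apply: leq_mul.
      by apply: (@leq_trans (2 ^ M)); [rewrite ltnW // ltn_expl | rewrite leq_exp2l].
    apply: (@leq_trans ((2 ^ om) ^ M)); first by rewrite leq_exp2r // ltnW // ltn_expl.
    rewrite -expnM leq_exp2l //.
    by rewrite expnS expn1 leq_mul.
  have U0 : 0 <= (2 ^+ U)^-1 :> R by rewrite invr_ge0 exprn_ge0.
  set c := (2 ^+ U)^-1 in U0 *; set y := (1 + _) ^+ N in H1 *.
  rewrite (_ : _ * _ * _ * _ * _ = M%:R * om%:R ^+ M * expR (m%:R * om%:R) * y * c); last by ring.
  rewrite ler_wpM2r // expnD natrM ler_pM // ?mulr_ge0 ?exprn_ge0 ?expR_ge0 //.
have small1 : K * ((2 ^ N)%:R / (2 ^ (6 * N))%:R) <= 4^-1.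
  apply: (@le_trans _ _ ((2 ^ (4 * N))%:R * ((2 ^ N)%:R / (2 ^ (6 * N))%:R))).
    by rewrite ler_wpM2r // divr_ge0.
  rewrite mulrA ler_pdivrMr ?ltr0n ?expn_gt0 // -[leRHS]mulrC ler_pdivlMr // -!natrM ler_nat.
  by rewrite (_ : 4 = 2 ^ 2)%N // -!expnD leq_exp2l //; lia.
have small2 : K * ((2 ^ (N + N ^ 2 + N + 2 * N ^ 3))%:R / 2 ^+ U) <= 4^-1.
  apply: (@le_trans _ _ ((2 ^ (4 * N))%:R * ((2 ^ (N + N ^ 2 + N + 2 * N ^ 3))%:R / 2 ^+ U))).
    by rewrite ler_wpM2r // divr_ge0 // exprn_ge0.
  rewrite mulrA ler_pdivrMr ?exprn_gt0 // -[leRHS]mulrC ler_pdivlMr // -!natrM -natrX ler_nat.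
  rewrite (_ : 4 = 2 ^ 2)%N // -!expnD leq_exp2l //; apply: leq_trans c3.
  by have : (N ^ 2 <= N ^ 3)%N by [rewrite leq_exp2l //; lia]; have : (N <= N ^ 2)%N;
    [rewrite -{1}(expn1 N) leq_exp2l //; lia| lia].
rewrite mulrDr.
have := ler_wpM2l K0 A1; have := ler_wpM2l K0 A2; lra.
Qed.
End ExpBounds.

Section Iterate.
Variable R : realType.

(** In every round the order is at least M, the number of zeros at least R0, and both are at most
    their extreme values; so the conditions of [extrapolate_nat] persist. *)
Lemma extrapolate_iter (r : nat) (T : finType) (p : T -> int) (al : T -> nat) (w : T -> R)
    (D : 'I_r -> T -> int) (th : 'I_r -> R) (J rho R0 M om d P t U : nat) :
  (0 < om)%N -> (0 < rho)%N -> (0 < R0)%N -> (forall t, expR (w t) = (al t)%:R) ->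
  (forall t, 0 <= w t <= om%:R) -> (forall t, `|\sum_i (D i t)%:~R * th i| <= om%:R) ->
  (forall t, `|w t - \sum_i (D i t)%:~R * th i| <= (2 ^+ U)^-1) ->
  (forall t, `|(p t)%:~R| <= (2 ^ P)%:R :> R) ->
  (forall i t, `|(D i t)%:~R| <= (2 ^ d)%:R :> R) ->
  (#|T| <= 2 ^ t)%N ->
  (256 * (om * rho) <= M)%N -> (d * r <= R0)%N -> (t + P <= 3 * (R0 * M))%N ->
  (10 * (rho ^ J * R0 * (2 ^ J * M)) ^ 3 + 2 <= U)%N ->
  vanishing p al D (2 ^ J * M) R0 -> vanishing p al D M (rho ^ J * R0).
Proof.
move=> om0 rho0 R00 wal wo w0o wd pP DD Tt c1 c2 c3 c4 van.
suff H j : (j <= J)%N -> vanishing p al D (2 ^ (J - j) * M) (rho ^ j * R0).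
  by have := H J (leqnn J); rewrite subnn mul1n.
elim: j => [|j IH] jJ; first by rewrite subn0 mul1n.
have {}IH := IH (ltnW jJ).
rewrite -[(J - j)%N]prednK ?subn_gt0 // -subnS expnS -mulnA in IH.
rewrite expnS -mulnA.
set m := (rho ^ j * R0)%N in IH *; set M' := (2 ^ (J - j.+1) * M)%N in IH *.
have R0m : (R0 <= m)%N by rewrite leq_pmull // expn_gt0 rho0.
have MM' : (M <= M')%N by rewrite leq_pmull // expn_gt0.
have M0 : (0 < M)%N by apply: leq_trans c1; rewrite !muln_gt0 om0 rho0.
have m0 : (0 < m)%N by apply: leq_trans R0m.
have R0Mm : (R0 * M <= m * M')%N by apply: leq_mul.
have mJ : (m <= rho ^ J * R0)%N by rewrite leq_mul2r leq_pexp2l ?orbT // ltnW.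
have MJ : (M' <= 2 ^ J * M)%N by rewrite leq_mul2r leq_exp2l ?leq_subr ?orbT.
apply: (extrapolate_nat _ om0 _ wal wo w0o wd pP DD Tt _ _ _ IH).
- exact: leq_trans MM'.
- by rewrite m0 leq_pmull.
- rewrite (mulnA om) mulnA mulnC leq_mul2l; apply/orP; right; exact: leq_trans c1 MM'.
- have : (d * (r * M') <= m * M')%N by rewrite mulnA leq_mul2r (leq_trans c2) ?orbT.
  by move: c3 R0Mm; lia.
- apply: leq_trans c4; rewrite leq_add2r leq_mul2l leq_exp2r //=.
  exact: leq_mul.
Qed.

Lemma siegel_vanishing (r : nat) (T : finType) (al : T -> nat) (D : 'I_r -> T ->
  int) (M R0 V : nat) :
  (0 < #|T|)%N -> (0 < V)%N -> (2 * (M ^ r * R0) <= #|T|)%N ->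
  (forall t (e : 'I_r -> nat) l, (forall i, (e i < M)%N) -> (0 < l <= R0)%N ->
     `|\prod_i D i t ^+ e i * (al t ^ l)%:Z| <= V%:Z) ->
  exists p : T -> int, [/\ exists t, p t != 0, forall t, `|p t| <= (2 * #|T| * V)%:Z &
    vanishing p al D M R0].
Proof.
move=> T0 V0 card bnd.
pose A (j : {ffun 'I_r -> 'I_M} * 'I_R0) t : int := \prod_i D i t ^+ (j.1 i) * (al t ^ j.2.+1)%:Z.
have [|j t|p [p0 pb pv]] := @siegel T _ A V T0 V0.
- by rewrite card_prod card_ffun !card_ord.
- by apply: bnd => [i|]; rewrite ?ltn_ord.
exists p; split=> // e eM l /andP [l0 lR].
have lt : (l.-1 < R0)%N by rewrite prednK.
apply: etrans (pv ([ffun i => Ordinal (eM i)], Ordinal lt)); apply: eq_bigr => t _.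
rewrite /A /= prednK // -mulrA [LHS]mulrC; congr (_ * _ * _).
by apply: eq_bigr => i _; rewrite ffunE.
Qed.
End Iterate.

End Extrapolation_method.

(* In baker_params, rho = 2 ^ baker_rhoA * x ^ baker_rhoB and L = 2 ^ baker_LA * x ^ baker_LB.
   There are L ^ r.+1 unknown coefficients and half as many equations, and the number of
   rounds is such that rho ^ J * R0 = L ^ r.+1: after J rounds, each of which halves the order
   of vanishing and multiplies the number of zeros by rho, there are as many zeros as
   coefficients. *)
Definition baker_rounds r := r * (r + 1) + 1.
(** Collects the factors 2^J, 256 and 2^(r + 2) of 2^J * M. *)
Definition baker_gA r := baker_rounds r + r + 10.
Definition baker_rhoB r := r * (r + 1) + 2 * r.
Definition baker_LB r := (1 + baker_rhoB r) * r + 2.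
(** R0 is 2 ^ (2 * baker_eta r) * x ^ 2. As [baker_LA] is affine in this number with slope 2 r^2 +
    2, the summands ensure that R0 exceeds (x + 1 + lam) * 2^r * 2^J. *)
Definition baker_eta r := baker_rounds r + r +
  (1 + (baker_gA r + (r + 1) + baker_gA r * (r * (r + 1))) * r) + (2 * r * r + 2) + baker_LB r + 2.
Definition baker_rhoA r := r + 1 + baker_gA r * (r * (r + 1)) + 2 * baker_eta r * r.
Definition baker_LA r := 1 + (baker_gA r + baker_rhoA r) * r + 2 * baker_eta r.
(** With [baker_B], the exponents of 16 * (L^(r + 1) * 2^J * M)^3; the cube comes from
    [extrapolate_nat]. *)
Definition baker_A r := 4 + 3 * (baker_LA r * (r + 1) + (baker_gA r + baker_rhoA r + baker_LA r)).
Definition baker_B r := 3 * (baker_LB r * (r + 1) + (1 + baker_rhoB r + baker_LB r)).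

Lemma monomialM x a b c d : (2 ^ a * x ^ b) * (2 ^ c * x ^ d) = 2 ^ (a + c) * x ^ (b + d).
Proof. by rewrite mulnACA -!expnD. Qed.

Lemma monomialX x a b n : (2 ^ a * x ^ b) ^ n = 2 ^ (a * n) * x ^ (b * n).
Proof. by rewrite expnMn -!expnM. Qed.

(** Here x bounds the bit lengths of the data, om the frequencies, and lam the bit length of L. *)
Lemma baker_params r x : 0 < x -> exists J rho R0 L M : nat,
  let om := 2 ^ (r + 2) * x * L in
  let lam := baker_LA r + baker_LB r * x in
  [/\ [/\ 0 < rho, 0 < R0, 0 < L & L <= 2 ^ lam],
   [/\ M = 256 * (om * rho), 2 * ((2 ^ J * M) ^ r * R0) = L ^ r.+1 & rho ^ J * R0 = L ^ r.+1],
   (x + 1 + lam) * r * 2 ^ J <= R0, lam <= R0 /\ lam <= L &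
   16 * (L ^ r.+1 * (2 ^ J * M)) ^ 3 = 2 ^ baker_A r * x ^ baker_B r].
Proof.
move=> x0; set A := baker_LA r; set B := baker_LB r.
pose rho := 2 ^ baker_rhoA r * x ^ baker_rhoB r.
pose R0 := 2 ^ (2 * baker_eta r) * x ^ 2.
pose L := 2 ^ A * x ^ B.
exists (baker_rounds r), rho, R0, L, (256 * (2 ^ (r + 2) * x * L * rho)) => om lam.
have xn n : 0 < x ^ n by rewrite expn_gt0 x0.
have pos a b : 0 < 2 ^ a * x ^ b by rewrite muln_gt0 xn expn_gt0.
have lamR : (x + 1 + lam) * (2 ^ r * 2 ^ baker_rounds r) <= R0.
  have H1 : x + 1 + lam <= (2 + A + B) * x by rewrite /lam; nia.
  have H2 : 2 + A + B <= 2 ^ (baker_eta r - r - baker_rounds r) * 2 ^ baker_eta r.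
    have e1 : 0 < baker_eta r by rewrite /baker_eta; lia.
    set c := baker_eta r - r - baker_rounds r.
    have cE : c = 2 + (1 + (baker_gA r + (r + 1) + baker_gA r * (r * (r + 1))) * r) + (2 * r * r +
      2) + B.
      by rewrite /c /baker_eta -/B; lia.
    have H : 2 + A + B <= c * baker_eta r.
      have := leq_pmulr (3 + B + (baker_gA r + (r + 1) + baker_gA r * (r * (r + 1))) * r) e1.
      by rewrite cE /A /baker_LA /baker_rhoA; lia.
    apply: (leq_trans H); apply: leq_mul; apply/ltnW/ltn_expl; lia.
  apply: (@leq_trans ((2 + A + B) * x * (2 ^ r * 2 ^ baker_rounds r))).
    by rewrite leq_mul2r H1 orbT.
  rewrite /R0 mulnAC; apply: leq_mul; last by rewrite expnS expn1 leq_pmulr.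
  apply: (leq_trans (leq_mul H2 (leqnn _))).
  rewrite mulnAC -!expnD leq_exp2l // mul2n -addnn leq_add2r /baker_eta; lia.
have lamR' : lam <= R0.
  apply: leq_trans lamR; rewrite -[X in X <= _]muln1; apply: leq_mul; first by rewrite leq_addl.
  by rewrite -expnD expn_gt0.
have omE : om = 2 ^ (r + 2 + A) * x ^ (1 + B) by rewrite /om /L -[x in 2 ^ (r + 2) * x]expn1
  monomialM.
have ME : 2 ^ baker_rounds r * (256 * (om * rho)) = 2 ^ (baker_gA r + baker_rhoA r + A) * x ^ (1 +
  baker_rhoB r + B).
  have e8 k : 256 * 2 ^ k = 2 ^ (8 + k) by rewrite expnD.
  rewrite omE /rho monomialM (mulnA 256) e8 mulnA -expnD; congr (2 ^ _ * x ^ _); last by lia.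
  by rewrite /baker_gA; lia.
split; [split| split | | split |].
- exact: pos.
- exact: pos.
- exact: pos.
- rewrite /L /lam expnD leq_mul2l [B * x]mulnC expnM; apply/orP; right.
  have [->|B0] := posnP B; first by rewrite !expn0.
  by rewrite leq_exp2r // ltnW // ltn_expl.
- by [].
- rewrite -/om ME /R0 /L !monomialX monomialM mulnA -expnS.
  congr (2 ^ _ * x ^ _); last by rewrite /B /baker_LB; lia.
  by rewrite /A /baker_LA; lia.
- rewrite /rho /R0 /L !monomialX monomialM; congr (2 ^ _ * x ^ _).
    by rewrite /A /baker_LA /baker_rhoA /baker_rounds; nia.
  by rewrite /B /baker_LB /baker_rhoB /baker_rounds; nia.
- apply: leq_trans lamR; rewrite -mulnA leq_mul2l; apply/orP; right.
  by rewrite leq_mul2r; apply/orP; right; apply/ltnW/ltn_expl.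
- exact: lamR'.
- apply: (leq_trans lamR'); rewrite /R0 /L; apply: leq_mul.
    by rewrite leq_exp2l // /A /baker_LA leq_addl.
  by rewrite leq_pexp2l // /B /baker_LB leq_addl.
rewrite -/om ME /L !monomialX monomialM monomialX mulnA (_ : 16 * _ = 2 ^ (4 + (A * r.+1 +
  (baker_gA r + baker_rhoA r + A)) * 3)); last by rewrite expnD.
rewrite /baker_A /baker_B -/A -/B; congr (2 ^ _ * x ^ _); lia.
Qed.

(** * Baker's lower bound *)

Section LowerBound.
Local Open Scope ring_scope.

Lemma PoszX n k : (n ^ k)%:Z = n%:Z ^+ k.
Proof. by rewrite -!natz natrX. Qed.

Section Baker.
Variable R : realType.

(** If the form were smaller, Siegel's coefficients would be extrapolated until [vanishing_trivial]
    kills them. As q divides no a i, the q-adic valuation of [al t] recovers [t.1]. *)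
Theorem log_form_lower_bound (r x q : nat) (a : 'I_r -> nat) (b : 'I_r -> int) (b0 : int) :
  (0 < x)%N -> prime q -> (forall i, 0 < a i)%N -> (forall i, ~~ (q %| a i)%N) ->
  (q <= 2 ^ x)%N -> (forall i, a i <= 2 ^ x)%N -> b0 != 0 -> `|b0| <= (2 ^ x)%:Z ->
  (forall i, `|b i| <= (2 ^ x)%:Z) ->
  (2 ^+ (2 ^ baker_A r * x ^ baker_B r))^-1 <=
    `|b0%:~R * ln q%:R + \sum_i (b i)%:~R * ln (a i)%:R| :> R.
Proof.
move=> x0 pq a0 qa qx ax b00 b0x bx; rewrite leNgt; apply/negP.
set Lm := _ + \sum_i _ => small.
have [J [rho [R0 [L [M]]]]] := baker_params r x0.
set om := (2 ^ (r + 2) * x * L)%N; set lam := (baker_LA r + baker_LB r * x)%N.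
move=> [[rho0 R00 L0 Llam] [Mdef siegelE RJ] dR0 [lamR lamL]].
set W := (2 ^ baker_A r * x ^ baker_B r)%N in small *; set M0 := (2 ^ J * M)%N in siegelE *.
set Y := ((L ^ r.+1 * M0) ^ 3)%N => WE.
pose d := (x + 1 + lam)%N.
pose T : finType := ('I_L * {ffun 'I_r -> 'I_L})%type.
pose al (t : T) := (q ^ t.1 * \prod_i a i ^ t.2 i)%N.
pose w (t : T) : R := t.1%:R * ln q%:R + \sum_i (t.2 i)%:R * ln (a i)%:R.
pose D i (t : T) : int := b0 * (t.2 i)%:Z - b i * t.1%:Z.
pose th i : R := ln (a i)%:R / b0%:~R.
have om0 : (0 < om)%N by rewrite !muln_gt0 expn_gt0 x0 L0.
have q0 := prime_gt0 pq.
have cT : #|T| = (L ^ r.+1)%N by rewrite card_prod card_ffun !card_ord expnS.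
have al0 t : (0 < al t)%N.
  rewrite muln_gt0 expn_gt0 q0 /=; apply: prodn_gt0 => i; by rewrite expn_gt0 a0.
have alinj t u : al t = al u -> t.1 = u.1.
  have lg v : logn q (al v) = v.1.
    rewrite lognM ?expn_gt0 ?q0 //; last by apply: prodn_gt0 => i; rewrite expn_gt0 a0.
    rewrite pfactorK // -[RHS]addn0; congr (_ + _)%N; apply/eqP.
    rewrite -leqn0 leqNgt logn_gt0 mem_primes pq /= negb_and.
    apply/orP; right; apply: (big_ind (fun y => ~~ (q %| y)%N)) => [|y z Hy Hz|i _];
      first by rewrite Euclid_dvd1.
      by rewrite Euclid_dvdM // negb_or Hy.
    by rewrite Euclid_dvdX // negb_and qa.
  by move=> E; apply/val_inj; rewrite /= -!lg E.
have w_al t : expR (w t) = (al t)%:R.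
  rewrite exp.expRD expR_sum natrM natr_prod natrX expRM_natl lnK ?posrE ?ltr0n //.
  by congr (_ * _); apply: eq_bigr => i _; rewrite expRM_natl lnK ?posrE ?ltr0n // natrX.
have wb t : 0 <= w t <= (r.+1 * L * x)%:R.
  have lq := @ln_nat_le R q x q0 qx; have la i := @ln_nat_le R (a i) x (a0 i) (ax i).
  have bnd (k : 'I_L) (l : R) : 0 <= l <= x%:R -> 0 <= k%:R * l <= (L * x)%:R.
    move=> /andP [l0 lx]; rewrite mulr_ge0 //= natrM ler_pM // ler_nat ltnW //.
  apply/andP; split.
    apply: addr_ge0; first by have /andP [] := bnd t.1 _ lq.
    by apply: sumr_ge0 => i _; have /andP [] := bnd (t.2 i) _ (la i).
  rewrite -mulnA mulSn natrD; apply: lerD; first by have /andP [] := bnd t.1 _ lq.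
  have -> : (r * (L * x))%:R = \sum_(i < r) (L * x)%:R :> R.
    by rewrite sumr_const card_ord natrM mulr_natl.
  by apply: ler_sum => i _; have /andP [] := bnd (t.2 i) _ (la i).
have omb : (r.+1 * L * x + 1 <= om)%N.
  have : (r.+1 < 2 ^ (r + 2))%N by rewrite addn2 expnS; have := ltn_expl r.+1 (ltnSn 1); lia.
  rewrite /om -mulnA [(L * x)%N]mulnC -mulnA; have : (0 < x * L)%N by rewrite muln_gt0 x0.
  nia.
have Yge : (L <= Y)%N.
  have M00 : (0 < M0)%N by rewrite /M0 Mdef muln_gt0 expn_gt0 !(muln_gt0 _ (om * _)) muln_gt0 om0
    rho0.
  rewrite /Y; apply: (@leq_trans (L ^ r.+1 * M0)).
    by rewrite -[X in (X <= _)%N]muln1 leq_mul // -[X in (X <= _)%N]expn1 leq_pexp2l.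
  by rewrite -[X in (X <= _)%N]expn1 leq_pexp2l // muln_gt0 expn_gt0 L0.
(* The form is multiplied by t.1 < L, which costs lam bits; W = 16 * Y leaves room, as lam <= L <=
   Y. *)
pose U := (W - lam)%N.
have U1 : (10 * Y + 2 <= U)%N by rewrite /U -WE; lia.
have lamW : (lam <= W)%N by rewrite -WE; lia.
have b0R : (b0%:~R : R) != 0 by rewrite intr_eq0.
have w0E t : w t - \sum_i (D i t)%:~R * th i = t.1%:R * (Lm / b0%:~R).
  have -> : \sum_i (D i t)%:~R * th i =
      \sum_i (t.2 i)%:R * ln (a i)%:R - t.1%:R / b0%:~R * \sum_i (b i)%:~R * ln (a i)%:R.
    rewrite mulr_sumr -sumrB; apply: eq_bigr => i _.
    by rewrite /D /th rmorphB !rmorphM /= -!pmulrn; field.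
  by rewrite /w /Lm; field.
have wd t : `|w t - \sum_i (D i t)%:~R * th i| <= (2 ^+ U)^-1.
  rewrite w0E normrM normrM normfV normr_nat.
  have b1 : 1 <= `|b0%:~R : R|.
    rewrite -intr_norm -[1]/(1%:~R) ler_int.
    by rewrite -gtz0_ge1 normr_gt0.
  have H1 : `|Lm| / `|b0%:~R| <= (2 ^+ W)^-1.
    rewrite ler_pdivrMr; last by lra.
    by apply: (le_trans (ltW small)); rewrite ler_peMr // invr_ge0 exprn_ge0.
  apply: (@le_trans _ _ ((2 ^ lam)%:R * (2 ^+ W)^-1)).
    apply: ler_pM; rewrite ?divr_ge0 ?normr_ge0 //.
    by rewrite ler_nat (leq_trans _ Llam) // ltnW.
  by rewrite /U natrX -exprVn -(subnK lamW) exprD addnK -[X in _ <= X]exprVn mulrA mulrC mulrA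
     -exprMn mulVf ?expr1n ?mul1r.
have w0b t : `|\sum_i (D i t)%:~R * th i| <= om%:R.
  have -> : \sum_i (D i t)%:~R * th i = w t - (w t - \sum_i (D i t)%:~R * th i) by rewrite opprB
    addrCA subrr addr0.
  apply: (le_trans (ler_normB _ _)).
  have U2 : (2 ^+ U)^-1 <= 1 :> R by rewrite invf_le1 ?exprn_gt0 // exprn_ege1 // ler1n.
  have /andP [w1 w2] := wb t; have := wd t; rewrite (ger0_norm w1).
  have : (r.+1 * L * x + 1)%:R <= om%:R :> R by rewrite ler_nat.
  rewrite natrD; lra.
have wo t : 0 <= w t <= om%:R.
  have /andP [-> w2] := wb t; apply: (le_trans w2); rewrite ler_nat; lia.
have Db i t : `|D i t| <= (2 ^ d)%:Z.
  apply: (le_trans (ler_normB _ _)); rewrite !normrM.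
  have h (c : int) (k : 'I_L) : `|c| <= (2 ^ x)%:Z -> `|c| * `|k%:Z| <= (2 ^ x * 2 ^ lam)%:Z.
    move=> cx; rewrite PoszM; apply: ler_pM => //.
    by rewrite lez_nat (leq_trans _ Llam) // ltnW //; exact: ltn_ord.
  apply: (le_trans (lerD (h _ _ b0x) (h _ _ (bx i)))).
  by rewrite -PoszD lez_nat addnn -mul2n mulnA -expnS -expnD leq_exp2l // /d; lia.
have alb t : (al t <= 2 ^ (2 * om))%N.
  rewrite -(ler_nat R) -w_al; apply: le_trans (expR_nat_le R om).
  by rewrite ler_expR; have /andP [] := wo t.
pose e0 := (d * (r * M0) + 2 * om * R0)%N.
have coef t (e : 'I_r -> nat) l : (forall i, (e i < M0)%N) -> (0 < l <= R0)%N ->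
     `|\prod_i D i t ^+ e i * (al t ^ l)%:Z| <= (2 ^ e0)%:Z.
  move=> eM /andP [l0 lR]; rewrite normrM expnD PoszM; apply: ler_pM => //.
    rewrite normr_prod.
    have -> : (2 ^ (d * (r * M0)))%:Z = \prod_(i < r) (2 ^ (d * M0))%:Z.
      by rewrite prodr_const card_ord -PoszX -expnM mulnAC mulnA.
    apply: ler_prod => i _; rewrite normr_ge0 normrX /=.
    apply: (@le_trans _ _ ((2 ^ d)%:Z ^+ e i)); first exact: lerXn2r.
    by rewrite -PoszX lez_nat -expnM leq_exp2l // leq_mul2l (ltnW (eM i)) orbT.
  rewrite ger0_norm // lez_nat (@leq_trans ((2 ^ (2 * om)) ^ l)) //.
    by rewrite leq_exp2r.
  by rewrite -expnM leq_exp2l // leq_mul2l lR orbT.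
have [|||p [[s ps] pb pv]] := siegel_vanishing (al := al) (D := D) (M := M0) (R0 := R0) _ _ _ coef.
- by rewrite cT expn_gt0 L0.
- by rewrite expn_gt0.
- by rewrite siegelE cT.
pose t0 := (r.+1 * lam)%N.
have Tt : (#|T| <= 2 ^ t0)%N by rewrite cT /t0 mulnC expnM leq_exp2r.
pose P := (1 + t0 + e0)%N.
have pP t : `|(p t)%:~R| <= (2 ^ P)%:R :> R.
  rewrite -intr_norm pmulrn ler_int; apply: (le_trans (pb t)); rewrite lez_nat /P !expnD.
  by rewrite leq_mul2r leq_mul2l Tt !orbT.
have DD i t : `|(D i t)%:~R| <= (2 ^ d)%:R :> R by rewrite -intr_norm pmulrn ler_int.
have M256 : (256 * (om * rho) <= M)%N by rewrite Mdef.
have dr : (d * r <= R0)%N by apply: leq_trans dR0; rewrite leq_pmulr // expn_gt0.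
have hM : (256 * om <= M)%N by apply: leq_trans M256; rewrite leq_mul2l leq_pmulr ?orbT.
have rom : (r.+1 <= om)%N.
  apply: leq_trans omb; apply: leq_trans (leq_addr _ _).
  by rewrite -mulnA leq_pmulr // muln_gt0 L0.
have lam0 : (0 < lam)%N by rewrite /lam /baker_LA -addnA.
have tP : (t0 + P <= 3 * (R0 * M))%N.
  have h1 : (d * (r * M0) <= R0 * M)%N by rewrite /M0 !mulnA leq_mul2r dR0 orbT.
  have h2 : (2 * om * R0 <= R0 * M)%N.
    by rewrite mulnC leq_mul2l; apply/orP; right; apply: leq_trans hM; rewrite leq_mul2r orbT.
  have h3 : (1 + 2 * t0 <= R0 * M)%N.
    have rM : (2 * r.+1 + 1 <= M)%N by move: hM rom; clear; lia.
    have := leq_mul lamR rM; rewrite /t0; move: lam0; clear; lia.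
  by rewrite /P /e0; move: h1 h2 h3; clear; lia.
have c4 : (10 * (rho ^ J * R0 * (2 ^ J * M)) ^ 3 + 2 <= U)%N by rewrite RJ.
have van := extrapolate_iter om0 rho0 R00 w_al wo w0b wd pP DD Tt M256 dr tP c4 pv.
have LM : (L <= M)%N.
  apply: leq_trans hM; apply: leq_trans (leq_pmull _ _) => //.
  by rewrite /om leq_pmull // muln_gt0 expn_gt0 x0.
have TR : (#|{: 'I_L * {ffun 'I_r -> 'I_L}}| <= rho ^ J * R0)%N by rewrite RJ -cT.
have := vanishing_trivial al0 alinj b00 LM TR van s.
by move/eqP; rewrite (negPf ps).
Qed.
End Baker.

End LowerBound.

(** * Primes p such that sigma(p^e) has few prime factors *)

Section Relations.
Local Open Scope ring_scope.

Section RepunitLog.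
Variable R : realType.

Lemma ln_prod_exp (P : seq nat) (l : nat -> nat) : all prime P ->
  ln (\prod_(q <- P) q ^ l q)%:R = \sum_(q <- P) (l q)%:R * ln q%:R :> R.
Proof.
elim: P => [|q P IH] /=; first by rewrite !big_nil ln1.
move=> /andP [pq aP]; have q0 := prime_gt0 pq.
rewrite !big_cons natrM lnM ?posrE ?ltr0n ?expn_gt0 ?q0 //; last first.
  rewrite big_seq; apply: prodn_cond_gt0 => s /(allP aP) /prime_gt0 s0.
  by rewrite expn_gt0 s0.
by rewrite IH // natrX lnXn ?ltr0n // mulr_natl.
Qed.

(** The quantity is ln (1 + 1 / (p^E - 1)), because (p - 1) * [repunit p E] = p^E - 1. *)
Lemma repunit_ln_defect p E : (1 < p)%N -> (0 < E)%N ->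
  0 <= E%:R * ln (p%:R : R) - ln (p.-1)%:R - ln (repunit p E)%:R <= (2 / 2 ^+ E : R).
Proof.
move=> p1 E0.
have pE : (2 ^ E <= p ^ E)%N by rewrite leq_exp2r.
have E2 : (2 <= 2 ^ E)%N by rewrite -{1}(expn1 2) leq_exp2l.
have pp : (0 < (p ^ E).-1)%N by lia.
have p0 : (0 < p.-1)%N by lia.
have lS : ln (p.-1)%:R + ln (repunit p E)%:R = ln ((p ^ E).-1)%:R :> R.
  by rewrite -repunitM natrM lnM ?posrE ?ltr0n // repunit_gt0.
have -> : E%:R * ln p%:R - ln (p.-1)%:R - ln (repunit p E)%:R =
    ln (1 + ((p ^ E).-1)%:R^-1) :> R.
  rewrite -addrA -opprD lS mulr_natl -lnXn ?ltr0n; last lia.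
  rewrite -ln_div ?posrE ?exprn_gt0 ?ltr0n //; last lia.
  congr ln; rewrite -natrX -{1}(@prednK (p ^ E)); last lia.
  by rewrite -natr1 mulrDl mul1r divff // pnatr_eq0; lia.
have i0 : 0 <= ((p ^ E).-1)%:R^-1 :> R by rewrite invr_ge0.
rewrite ln_ge0; last by rewrite lerDl.
apply: (le_trans (le_ln1Dx _)); first by lra.
rewrite -natrX ler_pdivlMr ?ltr0n ?expn_gt0 // mulrC ler_pdivrMr ?ltr0n //.
by rewrite -natrM ler_nat; lia.
Qed.
End RepunitLog.

(** The form has 4 k slots, for 2 k primes p and the 2 k numbers p - 1; the successor doubles the
    bound to absorb the size of the coefficients. *)
Definition relation_A k := (baker_A (2 * k + 2 * k)).+1.
Definition relation_B k := baker_B (2 * k + 2 * k).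

(* Siegel's lemma gives c <> 0 with prod_i (repunit (p i) (E i)) ^ c i = 1.  Then
   sum_i c i * (E i * ln (p i) - ln (p i - 1)) is tiny, and the largest p i with c i <> 0
   divides none of the other integers involved. *)
Lemma repunit_relation_bound (k y z Em : nat) (P : seq nat) (p E : 'I_(2 * k) -> nat) :
  (0 < k)%N -> uniq P -> all prime P -> size P = k -> (0 < y)%N -> injective p -> (forall i,
    prime (p i)) ->
  (forall i, p i <= 2 ^ y)%N -> (0 < Em)%N -> (forall i, Em <= E i < 2 ^ z)%N ->
  (forall i, smooth P (repunit (p i) (E i))) ->
  (Em <= 2 ^ relation_A k * (4 * k + y + 2 * z) ^ relation_B k)%N.
Proof.
move=> k0 uP aP sP y0 pinj pp py Em0 EE sm.
pose R := (Rdefinitions.R : realType).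
set n := (2 * k)%N in p E pinj pp py EE sm *.
have n0 : (0 < n)%N by rewrite muln_gt0.
have E0 i : (0 < E i)%N by have /andP [a _] := EE i; lia.
have S0 i : (0 < repunit (p i) (E i))%N by apply: repunit_gt0.
pose A (j : 'I_(size P)) (i : 'I_n) : int := (logn (nth 0 P j) (repunit (p i) (E i)))%:Z.
pose V := (y * 2 ^ z)%N.
have V0 : (0 < V)%N by rewrite muln_gt0 y0 expn_gt0.
have AV j i : `|A j i| <= V%:Z.
  rewrite ger0_norm // lez_nat.
  set q := nth 0 P j; have pq : prime q by apply: (allP aP); rewrite mem_nth.
  rewrite -(leq_exp2l _ _ (ltnSn 1)).
  apply: (@leq_trans (q ^ logn q (repunit (p i) (E i)))).
    have [->|l0] := posnP (logn q (repunit (p i) (E i))); first by rewrite !expn0.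
    by rewrite leq_exp2r // prime_gt1.
  apply: (leq_trans (dvdn_leq (S0 i) (pfactor_dvdnn _ _))).
  apply: (leq_trans (ltnW (repunit_ltX _ (prime_gt1 (pp i))))).
  apply: (@leq_trans ((2 ^ y) ^ E i)); first by rewrite leq_exp2r.
  rewrite -expnM leq_exp2l // leq_mul2l; apply/orP; right; apply: ltnW.
  by have /andP [] := EE i.
have [||c [[i1 ci1] cb cA]] := @siegel _ _ A V _ V0 _ AV.
- by rewrite card_ord.
- by rewrite !card_ord sP.
rewrite card_ord in cb.
have [i0 ci0 i0max] : exists2 i0, c i0 != 0 & forall j, c j != 0 -> (p j <= p i0)%N.
  by have := @arg_maxnP _ i1 (fun i => c i != 0) p ci1 => -[i ci H]; exists i.
set x := (4 * k + y + 2 * z)%N.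
(* The value 1 is a placeholder: [p i0] is the leading prime, kept apart, and where c j = 0 nothing
   relates p j to [p i0]. *)
pose a (i : 'I_(n + n)) : nat := match fintype.split i with
  | inl j => if (c j == 0) || (j == i0) then 1%N else p j
  | inr j => if c j == 0 then 1%N else (p j).-1 end.
pose b (i : 'I_(n + n)) : int := match fintype.split i with
  | inl j => if j == i0 then 0 else c j * (E j)%:Z
  | inr j => - c j end.
have p1 i := prime_gt1 (pp i).
have yx : (y <= x)%N by rewrite /x; lia.
have p2x i : (p i <= 2 ^ x)%N by apply: (leq_trans (py i)); rewrite leq_exp2l.
have x0 : (0 < x)%N by apply: leq_trans yx.
have n2 : (2 * n <= 2 ^ (4 * k))%N by apply: (@leq_trans (4 * k)); [rewrite /n;
  lia | apply/ltnW/ltn_expl].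
have y2 : (y <= 2 ^ y)%N by apply/ltnW/ltn_expl.
have nV : (2 * n * V <= 2 ^ (4 * k + y + z))%N.
  by rewrite /V (expnD 2 (4 * k + y) z) (expnD 2 (4 * k) y) mulnA; apply: leq_mul => //;
    apply: leq_mul.
have cE j : `|c j * (E j)%:Z| <= (2 ^ x)%:Z.
  rewrite normrM; apply: (@le_trans _ _ ((2 * n * V)%:Z * (2 ^ z)%:Z)).
    by apply: ler_pM => //; rewrite lez_nat ltnW //; have /andP [] := EE j.
  rewrite -PoszM lez_nat; apply: (@leq_trans (2 ^ (4 * k + y + z) * 2 ^ z)).
    by rewrite leq_mul2r nV orbT.
  by rewrite -expnD leq_exp2l // /x; lia.
have cx j : `|c j| <= (2 ^ x)%:Z.
  apply: (le_trans (cb j)); rewrite lez_nat; apply: (leq_trans nV).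
  by rewrite leq_exp2l // /x; lia.
have a0 i : (0 < a i)%N.
  rewrite /a; case: (fintype.split i) => j; case: ifP => // _; first exact: prime_gt0.
  by have := p1 j; lia.
have qa i : ~~ (p i0 %| a i)%N.
  rewrite /a; case: (fintype.split i) => j; case: ifP => [_|H]; rewrite ?Euclid_dvd1 //.
    move/norP: (negbT H) => [_ ji]; rewrite (dvdn_prime2 (pp i0) (pp j)).
    by apply: contra ji => /eqP /pinj ->.
  apply/negP => /dvdn_leq; have := i0max j (negbT H); have := p1 j; lia.
have ax i : (a i <= 2 ^ x)%N.
  rewrite /a; case: (fintype.split i) => j; case: ifP => // _; rewrite ?expn_gt0 //.
  by apply: leq_trans (p2x j); lia.
have bx i : `|b i| <= (2 ^ x)%:Z.
  rewrite /b; case: (fintype.split i) => j; last by rewrite normrN.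
  by case: ifP => // _; rewrite normr0.
have b00 : c i0 * (E i0)%:Z != 0 by rewrite mulf_neq0 // eqz_nat -lt0n.
have bk := @log_form_lower_bound R (n + n) x (p i0) a b (c i0 * (E i0)%:Z) x0 (pp i0) a0 qa (p2x
  i0) ax b00 (cE i0) bx.
pose u (j : 'I_n) : R := (E j)%:R * ln (p j)%:R - ln (p j).-1%:R - ln (repunit (p j) (E j))%:R.
have relS : \sum_j (c j)%:~R * ln (repunit (p j) (E j))%:R = 0 :> R.
  transitivity (\sum_(q <- P) ln q%:R * (\sum_j (c j)%:~R * (logn q (repunit (p j) (E j)))%:R) : R).
    under [RHS]eq_bigr do rewrite mulr_sumr.
    rewrite exchange_big; apply: eq_bigr => j _ /=.
    rewrite {1}(smooth_prod (S0 j) uP (sm j)) ln_prod_exp // mulr_sumr.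
    by apply: eq_bigr => q _; ring.
  rewrite (big_nth 0%N) big_mkord big1 // => j _.
  have -> : \sum_i (c i)%:~R * (logn (nth 0 P j) (repunit (p i) (E i)))%:R =
     (\sum_i A j i * c i)%:~R :> R.
    by rewrite raddf_sum; apply: eq_bigr => i _ /=; rewrite intrM mulrC.
  by rewrite cA mulr0.
have LE : (c i0 * (E i0)%:Z)%:~R * ln (p i0)%:R + \sum_i (b i)%:~R * ln (a i)%:R =
    \sum_j (c j)%:~R * u j :> R.
  have -> : \sum_j (c j)%:~R * u j = \sum_j (c j)%:~R * ((E j)%:R * ln (p j)%:R)
       + \sum_j - (c j)%:~R * ln (p j).-1%:R :> R.
    rewrite -big_split -[LHS]addr0 -[X in _ + X = _]relS -big_split /=; apply: eq_bigr => j _.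
    by rewrite /u; ring.
  rewrite big_split_ord /= addrA; congr (_ + _); last first.
    apply: eq_bigr => j _; rewrite /a /b -[rshift n j]/(unsplit (inr j)) unsplitK.
    by rewrite rmorphN /=; case: eqP => [->|//]; rewrite oppr0 !mul0r.
  rewrite (bigD1 i0) //= [in RHS](bigD1 i0) //= /b -[lshift n i0]/(unsplit (inl i0)) unsplitK eqxx
    mul0r add0r.
  rewrite intrM mulrA; congr (_ + _); apply: eq_bigr => j ji.
  rewrite /a -[lshift n j]/(unsplit (inl j)) unsplitK (negPf ji) orbF mulrA intrM.
  by case: eqP => [->|//]; rewrite !mul0r.
rewrite LE in bk.
have ub j : `|(c j)%:~R * u j| <= (2 * n * V)%:R * (2 / 2 ^+ Em) :> R.
  have /andP [u0 u1] := @repunit_ln_defect R _ _ (p1 j) (E0 j).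
  rewrite normrM; apply: ler_pM => //.
    by rewrite -intr_norm pmulrn ler_int.
  rewrite ger0_norm //; apply: (le_trans u1); rewrite ler_pM2l // lef_pV2 ?posrE ?exprn_gt0 //.
  by rewrite ler_weXn2l ?ler1n //; have /andP [] := EE j.
have sumb : `|\sum_j (c j)%:~R * u j| <= (n * (2 * n * V) * 2)%:R / 2 ^+ Em :> R.
  apply: (le_trans (ler_norm_sum _ _ _)); apply: (le_trans (ler_sum _ (fun j _ => ub j))).
  by rewrite sumr_const card_ord -[leLHS]mulr_natl !natrM !mulrA.
have := le_trans bk sumb; set W := (2 ^ _ * x ^ _)%N.
have : (n * (2 * n * V) * 2 <= 2 ^ (2 * x))%N.
  apply: (@leq_trans (2 ^ (4 * k) * 2 ^ (4 * k + y + z))); last first.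
    by rewrite -expnD leq_exp2l // /x; lia.
  by rewrite mulnAC [(n * 2)%N]mulnC leq_mul.
move=> H1 H2.
(* The form is at least 2^-W and at most 2^(2x - Em); since 2x <= W, Em is at most 2W. *)
have : (2 ^ Em <= 2 ^ (2 * x + W))%N.
  rewrite -(ler_nat R) expnD natrM !natrX.
  rewrite ler_pdivlMr ?exprn_gt0 // mulrC ler_pdivrMr ?exprn_gt0 // in H2.
  apply: (le_trans H2); rewrite ler_wpM2r ?exprn_ge0 // -natrX ler_nat //.
rewrite leq_exp2l // => /leq_trans; apply.
rewrite /relation_A expnS -[leqRHS]mulnA [leqRHS]mul2n -[leqRHS]addnn leq_add2r /W; apply: leq_mul.
  by rewrite -{1}(expn1 2) leq_exp2l.
by rewrite -{1}(expn1 x) leq_pexp2l // /baker_B muln_gt0 addn_gt0 orbC.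
Qed.

End Relations.

(** Sums the coefficients of 4k + y + 2z, for the z used in [two_blocks_contradiction], to bound it
    by a multiple of y * e. *)
Definition large_coef k := 4 * k + 3 + 2 * relation_A k + 2 * (relation_B k * (36 * k + 39)) + 4 *
  relation_B k.
Definition large_threshold k := 2 ^ relation_A k * large_coef k * (2 * relation_B k).
(** Above this value the integer (2 * relation_B k)-th root s of E exceeds
    [large_threshold k * y]. *)
Definition large_exponent k y := (large_threshold k * y).+1 ^ (2 * relation_B k).

Lemma root_floor n E : 0 < n -> exists s, s ^ n <= E < s.+1 ^ n.
Proof.
move=> n0; elim: E => [|E [s /andP [H1 H2]]].
  by exists 0; rewrite exp1n exp0n.
have [H|H] := ltnP E.+1 (s.+1 ^ n); first by exists s; rewrite H (leq_trans H1).
by exists s.+1; rewrite H /= (leq_ltn_trans H2) // ltn_exp2r.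
Qed.

Lemma relation_B_gt0 k : 0 < relation_B k.
Proof. by rewrite /relation_B /baker_B muln_gt0 addn_gt0 orbC. Qed.

(* E1 and E' are the least and the largest exponents of a first block of 2k primes; the first
   inequality is repunit_relation_bound for a second block with larger exponents, which are
   bounded by smooth_repunit_exponent_le in terms of E1. *)
Lemma two_blocks_contradiction k y E1 E' : 0 < k -> 0 < y -> 0 < E1 -> large_exponent k y <= E1 ->
  E' <= 2 ^ relation_A k * (4 * k + y + 2 * (16 * k + 17 + 2 * (y * E1))) ^ relation_B k ->
  ~ (forall z, E' < 2 ^ z -> E1 <= 2 ^ relation_A k * (4 * k + y + 2 * z) ^ relation_B k).
Proof.
move=> k0 y0 E10 lE HE' H.
have B0 := relation_B_gt0 k; set A := relation_A k in lE HE' H *;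
  set B := relation_B k in B0 lE HE' H *.
(* 36k + 34, 1 and 4 are the coefficients of 4k + y + 2 (16k + 17 + 2 y E1), all compared with y *
   E1. *)
set C1 := 36 * k + 39.
have B2 : 0 < 2 * B by rewrite mul2n double_gt0.
have [s /andP [s1 s2]] := root_floor E1 B2.
have sT : large_threshold k * y < s.
  by have := leq_ltn_trans lE s2; rewrite /large_exponent -/B (ltn_exp2r _ _ B2).
have s0 : 0 < s by apply: leq_ltn_trans sT.
set e := 2 * B * s.
have e0 : 0 < e by rewrite /e muln_gt0 B2.
have E1e : E1 < 2 ^ e.
  apply: (leq_trans s2); rewrite /e (mulnC (2 * B)) [in leqRHS]expnM (leq_exp2r _ _ B2);
    exact: ltn_expl.
have H1 : E' < 2 ^ (A + B * (C1 + y + e) + 1).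
  apply: (leq_ltn_trans HE'); rewrite addn1 expnS -[X in X < _]mul1n.
  apply: (@leq_ltn_trans (1 * 2 ^ (A + B * (C1 + y + e)))); last by rewrite ltn_mul2r expn_gt0.
  rewrite leq_mul2l /= expnD leq_mul2l; apply/orP; right.
  rewrite (mulnC B) [in leqRHS]expnM leq_exp2r // (expnD 2 (C1 + y) e) (expnD 2 C1 y).
  apply: (@leq_trans (C1 * y * E1)).
    have w0 : 0 < y * E1 by rewrite muln_gt0 y0.
    have := leq_pmulr (36 * k + 34) w0; have := leq_pmulr y E10.
    by rewrite /C1 -mulnA; clear; lia.
  by apply: leq_mul; [apply: leq_mul; apply/ltnW/ltn_expl | apply: ltnW].
(* Now log E' is linear in y and e, so H bounds E1 by (large_threshold k * y * s)^B < s^(2B) <=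
   E1. *)
have := H _ H1; apply/negP; rewrite -ltnNge.
apply: (@leq_trans (s ^ (2 * B))) => //.
apply: (@leq_ltn_trans ((2 ^ A * (large_coef k * (y * e))) ^ B)).
  rewrite expnMn; apply: leq_mul; first by rewrite -{1}(expn1 (2 ^ A)) leq_pexp2l ?expn_gt0.
  rewrite leq_exp2r // /large_coef -/A -/B -/C1.
  have w0 : 0 < y * e by rewrite muln_gt0 y0.
  have := leq_pmulr (4 * k + 2 + 2 * A + 2 * (B * C1)) w0.
  have := leq_pmulr (y * B) e0; have := leq_pmulr (B * e) y0; have := leq_pmulr y e0.
  by clear; nia.
rewrite [s ^ _]expnM ltn_exp2r // expnS expn1.
have -> : 2 ^ A * (large_coef k * (y * e)) = large_threshold k * y * s by rewrite /large_threshold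
  /e -/A -/B; lia.
by rewrite ltn_mul2r s0.
Qed.

(** By pigeonhole 4k of the primes share the same q in [smooth_repunit_exponent_le]. Sorted by
    exponent they form two blocks of 2k, and [repunit_relation_bound] applies to both. *)
Lemma few_large_exponents k y (P A : seq nat) (E : nat -> nat) : 0 < k -> 0 < y ->
  uniq P -> all prime P -> size P = k -> uniq A ->
  (forall p, p \in A -> [/\ prime p, p <= 2 ^ y, 1 < E p, large_exponent k y <= E p &
     smooth P (repunit p (E p))]) ->
  size A < 4 * k * k.
Proof.
move=> k0 y0 uP aP sP uA HA; rewrite ltnNge; apply/negP => big.
pose good p q := (q %| repunit p (E p)) && (E p <= 2 ^ (16 * k + 17) * q ^ 2).
(* The default 0 never occurs for p in A. *)
pose Q p := head 0 [seq q <- P | good p q].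
have QP p : p \in A -> Q p \in P /\ good p (Q p).
  move=> /HA [pp py E1 _ sm].
  have [q [qP d1 d2]] := smooth_repunit_exponent_le uP pp E1 sm.
  have : q \in [seq q <- P | good p q] by rewrite mem_filter qP /good d1 -sP d2.
  move=> /[dup] H; rewrite /Q; case E0 : [seq q <- P | good p q] H => [//|q' l] _.
  have : q' \in [seq q <- P | good p q] by rewrite E0 mem_head.
  by rewrite mem_filter => /andP [-> ->].
have [/hasP [q qP Hq]|/hasPn H] := boolP (has (fun q => 4 * k <= count (fun p => Q p == q) A) P);
  last first.
  have : size A <= \sum_(q <- P) count (fun p => Q p == q) A.
    have -> : \sum_(q <- P) count (fun p => Q p == q) A = \sum_(p <- A) \sum_(q <- P) (Q p == q).
      by rewrite exchange_big; apply: eq_bigr => q _; rewrite -sum1_count big_mkcond;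
      apply: eq_bigr => p _; case: eqP.
    rewrite -sum1_size big_seq [leqRHS]big_seq; apply: leq_sum => p /QP [Qp _].
    by rewrite (bigD1_seq (Q p)) //= eqxx.
  rewrite leqNgt => /negP; apply; apply: leq_trans big.
  apply: (@leq_ltn_trans (\sum_(q <- P) (4 * k).-1)).
    by rewrite !big_seq; apply: leq_sum => q /H; lia.
  rewrite big_const_seq count_predT iter_addn_0 sP; lia.
pose s := sort (fun p p' => E p <= E p') [seq p <- A | Q p == q].
have ss : 4 * k <= size s by rewrite size_sort size_filter.
have us : uniq s by rewrite sort_uniq filter_uniq.
have sA p : p \in s -> p \in A /\ Q p = q.
  by rewrite mem_sort mem_filter => /andP [/eqP -> ->].
have so : sorted (fun p p' => E p <= E p') s by apply: sort_sorted => p p'; apply: leq_total.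
have mono i j : i <= j -> j < 4 * k -> E (nth 0 s i) <= E (nth 0 s j).
  move=> ij j4; have jl := leq_trans j4 ss.
  apply: (sorted_leq_nth _ _ 0 so) => //; last by rewrite inE (leq_ltn_trans ij).
    by move=> a b c; apply: leq_trans.
pose pn i := nth 0 s i.
have mem i : i < 4 * k -> pn i \in s by move=> i4; rewrite mem_nth // (leq_trans i4).
pose p1 (i : 'I_(2 * k)) := pn i; pose p2 (i : 'I_(2 * k)) := pn (2 * k + i).
have l1 (i : 'I_(2 * k)) : i < 4 * k by have := ltn_ord i; lia.
have l2 (i : 'I_(2 * k)) : 2 * k + i < 4 * k by have := ltn_ord i; lia.
have inj i j : i < 4 * k -> j < 4 * k -> pn i = pn j -> i = j.
  move=> i4 j4 /eqP; rewrite nth_uniq // ?(leq_trans i4) ?(leq_trans j4) // => /eqP //.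
have D i : i < 4 * k -> [/\ prime (pn i), pn i <= 2 ^ y, 1 < E (pn i),
  large_exponent k y <= E (pn i) &
     smooth P (repunit (pn i) (E (pn i)))].
  by move=> /mem /sA [/HA].
pose E1 := E (pn 0); pose E' := E (pn (2 * k).-1).
have lt0 : 0 < 4 * k by lia.
have [pp0 py0 E01 lE0 _] := D 0 lt0.
have [_ _ El _ _] : [/\ prime (pn (2 * k).-1), pn (2 * k).-1 <= 2 ^ y, 1 < E',
  large_exponent k y <= E' &
     smooth P (repunit (pn (2 * k).-1) E')] by apply: D; lia.
(* The shared q divides [repunit (pn 0) E1], so all exponents, being at most 2^(16k + 17) q^2, are
   bounded in terms of the least one. *)
have qb : q < 2 ^ (y * E1).
  have [_ q0] := sA _ (mem 0 lt0); have [_ /andP [dq _]] := QP _ (proj1 (sA _ (mem 0 lt0))).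
  rewrite q0 in dq; apply: (leq_ltn_trans (dvdn_leq (repunit_gt0 _ (ltnW E01)) dq)).
  apply: (leq_trans (repunit_ltX _ (prime_gt1 pp0))).
  by rewrite expnM leq_exp2r // ltnW.
have cap i : i < 4 * k -> E (pn i) < 2 ^ (16 * k + 17 + 2 * (y * E1)).
  move=> i4; have [pA Qi] := sA _ (mem i i4); have [_ /andP [_ le]] := QP _ pA.
  apply: (leq_ltn_trans le); rewrite Qi (expnD 2 (16 * k + 17)) ltn_mul2l expn_gt0 /=.
  by rewrite [2 * (y * _)]mulnC [in ltnRHS]expnM ltn_exp2r.
apply: (@two_blocks_contradiction k y E1 E' k0 y0 (ltnW E01) lE0).
  apply: (@repunit_relation_bound k y _ E' P p2 (fun i => E (p2 i)) k0 uP aP sP y0).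
  - by move=> i j /(inj _ _ (l2 i) (l2 j)) /addnI /val_inj.
  - by move=> i; have [] := D _ (l2 i).
  - by move=> i; have [] := D _ (l2 i).
  - exact: ltnW.
  - by move=> i; rewrite cap // andbT; apply: mono => //; have := ltn_ord i; lia.
  - by move=> i; have [] := D _ (l2 i).
move=> z E'z.
apply: (@repunit_relation_bound k y z E1 P p1 (fun i => E (p1 i)) k0 uP aP sP y0).
- by move=> i j /(inj _ _ (l1 i) (l1 j)) /val_inj.
- by move=> i; have [] := D _ (l1 i).
- by move=> i; have [] := D _ (l1 i).
- exact: ltnW.
- move=> i; apply/andP; split; first exact: mono.
  by apply: leq_ltn_trans E'z; apply: mono; have := ltn_ord i; lia.
- by move=> i; have [] := D _ (l1 i).
Qed.

(** The count of primes up to 2^y has degree a quarter of this in [sparse_coef k * y]; the 4 is the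
    power in [sparse]. *)
Definition sparse_degree k := 4 * ((2 * relation_B k).+1 * k.+1).+1.
Definition sparse_coef k := large_threshold k + 4 * k + 2.
(** The threshold 4 b^2 c of [exp_dominates_poly] for b = [sparse_degree k] and c =
    [2 * sparse_coef k]. *)
Definition sparse_exponent k := 8 * sparse_degree k ^ 2 * sparse_coef k.

Lemma smooth_dvd P m n : 0 < n -> m %| n -> smooth P n -> smooth P m.
Proof.
move=> n0 mn sP p; rewrite mem_primes => /and3P [pp _ pm]; apply: sP.
by rewrite mem_primes pp n0 (dvdn_trans pm).
Qed.

Lemma repunit_dvd_sigma N p : 0 < N -> p \in primes N -> repunit p (logn p N).+1 %| sigma N.
Proof. by move=> N0 pN; rewrite sigmaE // (bigD1_seq p) ?primes_uniq //= dvdn_mulr. Qed.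

Section CountPrimes.
Variables (k N : nat) (P : seq nat).
Hypotheses (k0 : 0 < k) (N0 : 0 < N) (uP : uniq P) (aP : all prime P) (sP : size P = k).
Hypothesis smN : smooth P (sigma N).

Let E p := (logn p N).+1.

Lemma primes_exponent p : p \in primes N -> [/\ prime p, 1 < E p & smooth P (repunit p (E p))].
Proof.
move=> pN; split; first by move: pN; rewrite mem_primes => /and3P [].
  by rewrite ltnS logn_gt0.
exact: smooth_dvd (sigma_gt0 N0) (repunit_dvd_sigma N0 pN) smN.
Qed.

Lemma count_large_exponents y : 0 < y ->
  size [seq p <- primes_upto N (2 ^ y) | large_exponent k y <= E p] < 4 * k * k.
Proof.
move=> y0; apply: (few_large_exponents (E := E) k0 y0 uP aP sP);
  first by rewrite !filter_uniq ?primes_uniq.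
move=> p; rewrite !mem_filter => /and3P [lE py /primes_exponent [pp E1 sm]].
by split.
Qed.

Lemma count_primes_upto y : 0 < y ->
  size (primes_upto N (2 ^ y)) <= 4 * k * k + (large_exponent k y).+1 * (large_exponent k y *
    y).+1 ^ k.
Proof.
move=> y0; rewrite -(count_predC (fun p => large_exponent k y <= E p)) -!size_filter.
apply: leq_add; first exact/ltnW/count_large_exponents.
rewrite -[X in _ <= _ * _ ^ X]sP; apply: (@count_small_exponents P _ E y (large_exponent k y) uP).
  by rewrite !filter_uniq ?primes_uniq.
move=> p; rewrite !mem_filter /= -ltnNge => /and3P [lE py /primes_exponent [pp E1 sm]].
by split=> //; rewrite E1 ltnW.
Qed.

(** The count up to 2^y is polynomial in y, where 2^y is the first power of 2 above Y; the
    exponential 2^y <= 2 Y wins. *)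
Lemma sparse_smooth : sparse N (2 ^ sparse_exponent k).
Proof.
move=> Y YY; set b := sparse_degree k; set be := sparse_coef k.
have Y0 : 0 < Y by apply: leq_trans YY; rewrite expn_gt0.
set y := (trunc_log 2 Y).+1.
have /andP [Y1 Y2] := trunc_log_bounds (ltnSn 1) Y0.
have yeta : sparse_exponent k <= y.
  by rewrite ltnW // -(ltn_exp2l _ _ (ltnSn 1)); apply: leq_ltn_trans Y2.
have y0 : 0 < y by [].
have sz : size (primes_upto N Y) <= size (primes_upto N (2 ^ y)).
  rewrite !size_filter; apply: sub_count => p /= pY; apply: leq_trans pY _; exact: ltnW.
set x := be * y.
have xE : x = large_threshold k * y + 4 * k * y + 2 * y by rewrite /x /be /sparse_coef !mulnDl.
have xge c : c <= be -> c <= x by move=> H; rewrite /x (leq_trans H) // leq_pmulr.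
have x2 : 2 <= x by apply: xge; rewrite /be /sparse_coef leq_addl.
have x0 : 0 < x by apply: leq_trans x2.
have kx : 4 * k <= x by apply: xge; rewrite /be /sparse_coef; lia.
have B0 := relation_B_gt0 k; set B := relation_B k in B0 *.
have LZ : large_exponent k y <= x ^ (2 * B).
  have B2 : 0 < 2 * B by rewrite mul2n double_gt0.
  by rewrite /large_exponent -/B (leq_exp2r _ _ B2) xE; move: y0; clear; lia.
have L1 : (large_exponent k y).+1 <= x ^ (2 * B).+1.
  rewrite expnS; apply: (@leq_trans (2 * x ^ (2 * B))); last by rewrite leq_mul2r x2 orbT.
  by have : 0 < x ^ (2 * B) by [rewrite expn_gt0 x0]; lia.
have yx : y.+1 <= x by rewrite xE; move: y0; clear; lia.
have L2 : (large_exponent k y * y).+1 <= x ^ (2 * B).+1.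
  rewrite expnSr; apply: (@leq_trans (x ^ (2 * B) * y.+1)); last by rewrite leq_mul2l yx orbT.
  have : large_exponent k y * y <= x ^ (2 * B) * y by rewrite leq_mul2r LZ orbT.
  by have : 0 < x ^ (2 * B) by [rewrite expn_gt0 x0]; rewrite mulnS; lia.
have D1 : size (primes_upto N (2 ^ y)) <= x ^ ((2 * B).+1 * k.+1).+1.
  apply: (leq_trans (count_primes_upto y0)).
  have A1 : (large_exponent k y).+1 * (large_exponent k y * y).+1 ^ k <= x ^ ((2 * B).+1 * k.+1).
    by rewrite mulnS expnD expnM; apply: leq_mul => //; rewrite leq_exp2r.
  have A2 : 4 * k * k <= x ^ ((2 * B).+1 * k.+1).
    apply: (@leq_trans (x ^ 2)); first by rewrite expnS expn1; apply: leq_mul => //; lia.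
    by rewrite leq_pexp2l //; clear -B0 k0; nia.
  by rewrite expnS; move: x2 A1 A2; set w := x ^ _; clear; nia.
have D2 : size (primes_upto N Y) ^ 4 <= x ^ b.
  rewrite /b /sparse_degree mulnC expnM leq_exp2r //; exact: leq_trans sz D1.
apply: (leq_trans D2); rewrite -(@leq_pmul2l 2) //.
apply: (@leq_trans (2 ^ y)); last by rewrite /y expnS leq_mul2l.
apply: (@leq_trans ((2 * be * y) ^ b)).
  rewrite -mulnA expnMn leq_mul2r; apply/orP; right.
  by rewrite -{1}(expn1 2) leq_exp2l.
apply: exp_dominates_poly => //; apply: leq_trans yeta.
by rewrite /sparse_exponent -/b -/be; clear; nia.
Qed.
End CountPrimes.

(** This serves for M, which divides sigma(N) and so has few prime factors. *)
Lemma sparse_few k X : 0 < k -> size (primes X) <= k -> sparse X (2 ^ sparse_exponent k).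
Proof.
move=> k0 sX Y; apply: leq_trans.
apply: (@leq_trans (k ^ 4)).
  by rewrite leq_exp2r // (leq_trans _ sX) // size_filter count_size.
apply: (@leq_trans ((2 ^ k) ^ 4)); first by rewrite leq_exp2r // ltnW // ltn_expl.
rewrite -expnM leq_exp2l // /sparse_exponent /sparse_coef mulnC.
have : 0 < sparse_degree k ^ 2 by rewrite expn_gt0.
by set c := sparse_degree k ^ 2; clear; nia.
Qed.

(** * Prime factors below the bound *)

(* 2 ^ scale_exp k is 8 * H0 ^ 2, where H0 = 2 ^ (2 * sparse_exponent k + 2) bounds both a * b
   and the product N0 of the p^e || N with sigma(p^e) < prime_bound k;
   prime_bound k is such that repunit p E >= prime_bound k and p <= 2 ^ top_exp k force
   large_exponent k (top_exp k) <= E. *)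
Definition max_large k := 4 * k * k.
Definition scale_exp k := 4 * sparse_exponent k + 7.
(** If T is one scale and w = T ^ (max_large k).+1, the next is w^2: w dominates a product of
    [max_large k] primes below T, and the primes from w^2 on have a tail of size 2 / w. *)
Definition scale k i := 2 ^ (scale_exp k * (2 * (max_large k).+1) ^ i).
Definition top_exp k := scale_exp k * (2 * (max_large k).+1) ^ (max_large k).+1.
Definition prime_bound k := 2 ^ (top_exp k * large_exponent k (top_exp k) + max_large k + top_exp
  k + 2).

Lemma scaleS k i : scale k i.+1 = (scale k i ^ (max_large k).+1) ^ 2.
Proof. by rewrite /scale -!expnM expnS mulnCA mulnC [2 * _]mulnC mulnA. Qed.

Lemma leq_scale k i j : i <= j -> scale k i <= scale k j.
Proof. by move=> ij; rewrite leq_exp2l // leq_mul2l leq_pexp2l ?orbT. Qed.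

Lemma count_lt (a b : pred nat) s p : subpred a b -> p \in s -> b p -> ~~ a p ->
  count a s < count b s.
Proof.
move=> ab + bp ap; elim: s => // q s IH; rewrite inE /= => /orP [/eqP <-|/IH lt].
  by rewrite (negPf ap) bp add0n add1n ltnS sub_count.
by rewrite -addnS leq_add //; case: (a q) (ab q) => // ->.
Qed.

(** [max_large k] elements cannot meet [max_large k] + 1 disjoint intervals: otherwise at least n
    elements lie below [scale k n]. *)
Lemma empty_scale k (J : seq nat) : count (fun p =>
  p <= scale k (max_large k).+1) J <= max_large k ->
  exists2 i, i <= max_large k & all (fun p => (p <= scale k i) || (scale k i.+1 < p)) J.
Proof.
move=> cJ; set K := max_large k in cJ *.
have [/hasP [i iK H]|/hasPn H] := boolP (has (fun i =>
    all (fun p => (p <= scale k i) || (scale k i.+1 < p)) J) (iota 0 K.+1)).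
  by exists i => //; move: iK; rewrite mem_iota add0n ltnS.
suff C n : n <= K.+1 -> n <= count (fun p => p <= scale k n) J.
  by have := leq_trans (C _ (leqnn _)) cJ; rewrite ltnn.
elim: n => // n IH nK; have {}IH := IH (ltnW nK).
have := H n; rewrite mem_iota add0n => /(_ nK); rewrite -has_predC => /hasP [p pJ].
rewrite /= negb_or -ltnNge -leqNgt => /andP [p1 p2].
apply: (leq_ltn_trans IH); apply: (count_lt _ pJ p2); last by rewrite -ltnNge.
by move=> q /= qn; apply: leq_trans qn (leq_scale _ _).
Qed.

Section Scales.
Variables (k X Y a b : nat).
Hypotheses (k0 : 0 < k) (X0 : 0 < X) (Y0 : 0 < Y) (oX : odd X) (XY1 : (1 < X) || (1 < Y)).
Hypotheses (sX : sigma X = a * Y) (sY : sigma Y = b * X).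
Hypotheses (spX : sparse X (2 ^ sparse_exponent k)) (spY : sparse Y (2 ^ sparse_exponent k)).
Hypothesis largeY : forall q, q \in primes Y -> prime_bound k <= q.

Let C := prime_bound k.
Let r p := repunit p (logn p X).+1.

Hypothesis few : size [seq p <- primes X | (C <= r p) && (p <= 2 ^ top_exp k)] <= max_large k.

Local Open Scope ring_scope.

(** a b is at most the product of X / phi(X) and Y / phi(Y). The second is at most 2, as the primes
    of Y are large; the first is at most 2 n^2, cutting the primes of X at n^2. *)
Lemma abundancy_bound : (a * b <= 2 ^ (2 * sparse_exponent k + 2))%N.
Proof.
set n := (2 ^ sparse_exponent k)%N.
have eta2 : (2 <= sparse_exponent k)%N.
  rewrite /sparse_exponent /sparse_coef addn2 mulnS;
    have : (0 < sparse_degree k ^ 2)%N by rewrite expn_gt0.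
  by rewrite -mulnA; lia.
have n4 : (4 <= n)%N by rewrite -[4%N]/(2 ^ 2)%N leq_exp2l.
have n0 : (0 < n)%N by apply: leq_trans n4.
have nn : (n <= n ^ 2)%N by rewrite expnS expn1 leq_pmulr.
have nR : 0 < n%:R :> rat by rewrite ltr0n.
have half : 2^-1 <= 1 - 2 / n%:R :> rat.
  have : 2 / n%:R <= 2^-1 :> rat by rewrite ler_pdivrMr // ler_pdivlMl // -natrM ler_nat.
  by lra.
have GY : 2^-1 <= \prod_(p <- primes Y) defect p.
  apply: (le_trans half); apply: (prod_defect_tail spY n0 nn) => //.
  apply/allP => q /largeY; apply: leq_trans.
  rewrite -expnM leq_exp2l // /top_exp /scale_exp.
  apply: (@leq_trans (4 * sparse_exponent k + 7)%N); first by lia.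
  apply: (@leq_trans ((4 * sparse_exponent k + 7) * (2 * (max_large k).+1) ^ (max_large k).+1)%N).
    by rewrite leq_pmulr // expn_gt0.
  by lia.
have GX : (n ^ 2)%:R^-1 * 2^-1 <= \prod_(p <- primes X) defect p.
  rewrite -(perm_big _ (permEl (perm_filterC (fun p => p <= n ^ 2)%N (primes X)))) big_cat /=.
  apply: ler_pM; rewrite ?invr_ge0 ?ler0n //.
    apply: prod_defect_all; rewrite ?filter_uniq ?primes_uniq ?expn_gt0 ?n0 //.
      by apply/allP => p; rewrite mem_filter mem_primes => /andP [_ /and3P [/prime_gt1]].
    exact: filter_all.
  apply: (le_trans half); apply: (prod_defect_tail spX n0 nn); first exact: filter_subseq.
  by apply/allP => p; rewrite mem_filter /= -ltnNge => /andP [/ltnW].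
have hX := sigma_defect_le X0; have hY := sigma_defect_le Y0.
set gX := \prod_(p <- primes X) _ in GX hX; set gY := \prod_(p <- primes Y) _ in GY hY.
have XR : 0 < X%:R :> rat by rewrite ltr0n.
have YR : 0 < Y%:R :> rat by rewrite ltr0n.
have n2R : 0 < (n ^ 2)%:R^-1 :> rat by rewrite invr_gt0 ltr0n expn_gt0 n0.
have gX0 : 0 <= gX by apply: prod_defect_ge0.
have gY0 : 0 <= gY by apply: prod_defect_ge0.
have H : (a * b)%:R * (gX * gY) <= 1.
  rewrite -(ler_pM2r (mulr_gt0 XR YR)) mul1r.
  have -> : (a * b)%:R * (gX * gY) * (X%:R * Y%:R) = (sigma X)%:R * gX * ((sigma Y)%:R * gY).
    by rewrite sX sY !natrM; ring.
  by apply: ler_pM => //; rewrite mulr_ge0 ?ler0n.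
have {}H : (a * b)%:R * ((n ^ 2)%:R^-1 * 2^-1 * 2^-1) <= 1 :> rat.
  apply: le_trans H; apply: ler_wpM2l; first exact: ler0n.
  by apply: ler_pM => //; rewrite ?mulr_ge0 // ltW.
have -> : (2 ^ (2 * sparse_exponent k + 2) = n ^ 2 * 4)%N by rewrite expnD mulnC [in RHS]mulnC
  (mulnC 2) expnM.
rewrite -(ler_nat rat).
have n2 : (n ^ 2)%:R != 0 :> rat by rewrite pnatr_eq0 expn_eq0 negb_and -lt0n n0.
have : (a * b)%:R * ((n ^ 2)%:R^-1 * 2^-1 * 2^-1) * (n ^ 2 * 4)%:R <= 1 * (n ^ 2 * 4)%:R :> rat.
  by rewrite ler_wpM2r // ler0n.
have -> : (a * b)%:R * ((n ^ 2)%:R^-1 * 2^-1 * 2^-1) * (n ^ 2 * 4)%:R = (a * b)%:R :> rat.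
  by rewrite (natrM _ (n ^ 2)); field; rewrite gt_eqF.
by rewrite mul1r.
Qed.

(** The primes with sigma(p^e) < C form s0; an interval of scales without primes of the rest J
    separates J1 from J2, and [no_small_ratio_gap] applies. *)
Lemma scales_contradiction : False.
Proof.
set K := max_large k.
pose J := [seq p <- primes X | (C <= r p)%N].
pose s0 := [seq p <- primes X | ~~ (C <= r p)%N].
have topE : scale k K.+1 = (2 ^ top_exp k)%N by [].
have cJ : (count (fun p => p <= scale k K.+1)%N J <= K)%N.
  rewrite topE -size_filter -filter_predI.
  have few' : (size [seq p <- primes X | (C <= r p) && (p <= 2 ^ top_exp k)] <= K)%N := few.
  apply: leq_trans few'.
  by rewrite !size_filter; apply: sub_count => p /andP [h1 h2]; apply/andP; split.
have [i iK /allP gap] := empty_scale cJ.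
pose J1 := [seq p <- J | (p <= scale k i)%N]; pose J2 := [seq p <- J | ~~ (p <= scale k i)%N].
have perm : perm_eq (primes X) (s0 ++ J1 ++ J2).
  rewrite perm_sym; apply: (perm_trans (y := s0 ++ J)).
    by rewrite perm_cat2l perm_filterC.
  by rewrite perm_catC perm_filterC.
have topC : (2 ^ top_exp k <= C)%N by rewrite leq_exp2l //; lia.
have scC j : (j <= K.+1)%N -> (scale k j <= C)%N.
  by move=> jK; apply: leq_trans topC; rewrite -topE leq_scale.
have s0C p : p \in s0 -> (r p < C)%N by rewrite mem_filter -ltnNge => /andP [].
have cop p : p \in s0 -> coprime (r p) Y.
  move=> /s0C rC; rewrite coprime_has_primes ?repunit_gt0 //; apply/hasPn => q qY; apply/negP => qr.
  have : q \in primes (r p) := qr; rewrite mem_primes => /and3P [_ _ /dvdn_leq];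
    rewrite repunit_gt0 // => /(_ isT).
  by rewrite leqNgt (leq_trans rC (largeY qY)).
have CJ p : p \in J1 -> (C <= r p)%N by rewrite !mem_filter => /and3P [].
have sJ : (size J1 <= K)%N.
  apply: leq_trans cJ; rewrite size_filter; apply: sub_count => p /= pi.
  by apply: leq_trans pi _; apply: leq_scale; lia.
set T := scale k i in J1 J2 perm CJ sJ gap *.
pose w := (T ^ K.+1)%N.
have T0 : (2 ^ scale_exp k <= T)%N.
  by rewrite /T /scale leq_exp2l // leq_pmulr // expn_gt0.
have Tpos : (0 < T)%N by rewrite expn_gt0.
have Tw : (T <= w)%N by rewrite -{1}(expn1 T) leq_pexp2l.
have w2 : scale k i.+1 = (w ^ 2)%N by rewrite scaleS.
have w1 : (1 < w)%N.
  apply: leq_trans Tw; apply: leq_trans T0; rewrite -[2%N]/(2 ^ 1)%N leq_exp2l // /scale_exp; lia.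
have w0 := ltnW w1.
have etaw : (2 ^ sparse_exponent k <= w ^ 2)%N.
  apply: (@leq_trans w); last by rewrite expnS expn1 leq_pmulr.
  apply: leq_trans Tw; apply: leq_trans T0; rewrite leq_exp2l // /scale_exp; lia.
have w2C : (w ^ 2 <= C)%N by rewrite -w2 scC.
have tail2 : 1 - 2 / w%:R <= \prod_(p <- J2) defect p.
  apply: (prod_defect_tail spX w0 etaw).
    by apply: subseq_trans (filter_subseq _ _) (filter_subseq _ _).
  apply/allP => p; rewrite mem_filter => /andP [pT pJ]; have := gap p pJ.
  by rewrite (negPf pT) /= w2 => /ltnW.
have tailY : 1 - 2 / w%:R <= \prod_(p <- primes Y) defect p.
  apply: (prod_defect_tail spY w0 etaw) => //.
  by apply/allP => q /largeY; apply: leq_trans.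
have hH := abundancy_bound; set H0 := (2 ^ _)%N in hH.
have ab0 : (0 < a)%N && (0 < b)%N.
  have := sigma_gt0 X0; have := sigma_gt0 Y0; rewrite sX sY !muln_gt0.
  by move=> /andP [-> _] /andP [-> _].
have [a0 b0] := andP ab0.
(* N0 is at most sigma(N0), which divides a. *)
have N0H : (\prod_(p <- s0) p ^ logn p X <= H0)%N.
  apply: leq_trans hH; apply: (@leq_trans (\prod_(p <- s0) r p)%N).
    by apply: leq_prod => p _; apply: repunit_geX.
  apply: (@leq_trans a); last by rewrite leq_pmulr.
  exact: (dvdn_leq a0 (small_part_dvd X0 sX perm cop)).
have Q1 : (\prod_(p <- J1) p.-1 <= T ^ K)%N.
  apply: (@leq_trans (T ^ size J1)%N); last by rewrite leq_pexp2l.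
  have -> : (T ^ size J1 = \prod_(p <- J1) T)%N by rewrite big_const_seq count_predT iter_muln_1.
  rewrite !big_seq; apply: leq_prod => p; rewrite mem_filter => /andP [pT _].
  exact: leq_trans (leq_pred _) pT.
set Bq := (\prod_(p <- s0) p ^ logn p X * \prod_(p <- J1) p.-1)%N.
have H00 : (0 < H0)%N by rewrite expn_gt0.
(* a b Bq is at most H0^2 T^K, and 8 H0^2 = 2 ^ scale_exp k <= T. *)
have hB : (4 * (a * b * Bq) < w)%N.
  have h1 : (a * b * Bq <= H0 * (H0 * T ^ K))%N by apply: leq_mul => //; apply: leq_mul.
  have h2 : (8 * (H0 * (H0 * T ^ K)) <= w)%N.
    rewrite /w expnS !mulnA leq_mul2r; apply/orP; right; apply: leq_trans T0.
    rewrite -[8%N]/(2 ^ 3)%N /H0 -!expnD leq_exp2l // /scale_exp; lia.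
  have h3 : (0 < H0 * (H0 * T ^ K))%N by rewrite muln_gt0 H00 muln_gt0 H00 (expn_gt0 T K) Tpos.
  by move: h1 h2 h3; clear; lia.
have KB : (K * (a * b * Bq + 1) < C)%N.
  apply: (@leq_ltn_trans (K * w ^ 2)%N).
    rewrite leq_mul2l; apply/orP; right; apply: (@leq_trans w).
      by move: hB w0; clear; lia.
    by rewrite expnS expn1 leq_pmulr.
  apply: (@leq_trans (2 ^ K * 2 ^ top_exp k)%N).
    apply: (@leq_ltn_trans (K * 2 ^ top_exp k)%N); last by rewrite ltn_mul2r expn_gt0 ltn_expl.
    by rewrite leq_mul2l -w2 -topE leq_scale ?orbT.
  by rewrite -expnD leq_exp2l // -/K; clear; lia.
exact: (no_small_ratio_gap X0 Y0 oX XY1 sX sY perm cop CJ sJ w1 tail2 tailY hB KB).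
Qed.
End Scales.

(** The counting lemmas take a list of exactly k primes, whereas sigma(N) may have fewer. *)
Lemma extend_primes (s : seq nat) n : uniq s -> all prime s -> size s <= n ->
  exists P, [/\ uniq P, all prime P, size P = n & {subset s <= P}].
Proof.
move=> us ps /subnK <-; elim: (n - size s) => [|m [P [uP aP sP sub]]].
  by exists s; split.
have [p pb pp] := prime_above (\max_(q <- P) q).
exists (p :: P); split=> /=; rewrite ?sP ?pp ?uP ?andbT //.
  apply/negP => pP; move: pb; rewrite ltnNge => /negP; apply.
  by rewrite (big_rem p) //= leq_maxl.
by move=> q /sub; rewrite inE orbC => ->.
Qed.

(** * Computability of the bound *)

Lemma computable_comp F f : effectively_computable F -> effectively_computable f ->
  effectively_computable (fun k => F (f k)).
Proof. exact: recursive_comp1. Qed.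

(** Peels off the outermost operation. Constants are tried first, and named functions are resolved
    by hypotheses placed in the context beforehand. *)
Ltac computable := repeat (cbv beta; match goal with
  | |- effectively_computable (fun _ => ?c) => exact: (computable_const c)
  | |- effectively_computable (fun k => k) => exact: computable_id
  | H : effectively_computable ?F |- effectively_computable (fun k => ?F (@?g k)) =>
      apply: (computable_comp (f := g) H)
  | |- effectively_computable (fun k => addn (@?f k) (@?g k)) =>
      apply: (computable_add (f := f) (g := g))
  | |- effectively_computable (fun k => muln (@?f k) (@?g k)) =>
      apply: (computable_mul (f := f) (g := g))
  | |- effectively_computable (fun k => expn (@?f k) (@?g k)) =>
      apply: (computable_exp (f := f) (g := g))
  | |- effectively_computable (fun k => S (@?f k)) => apply: (computable_succ (f := f))
  end).

Lemma computable_baker_rounds : effectively_computable baker_rounds.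
Proof. rewrite /baker_rounds; computable. Qed.

Lemma computable_baker_gA : effectively_computable baker_gA.
Proof. rewrite /baker_gA; have := computable_baker_rounds => ?; computable. Qed.

Lemma computable_baker_rhoB : effectively_computable baker_rhoB.
Proof. rewrite /baker_rhoB; computable. Qed.

Lemma computable_baker_LB : effectively_computable baker_LB.
Proof. rewrite /baker_LB; have := computable_baker_rhoB => ?; computable. Qed.

Lemma computable_baker_eta : effectively_computable baker_eta.
Proof.
rewrite /baker_eta; have := computable_baker_rounds => ?; have := computable_baker_gA => ?.
have := computable_baker_LB => ?; computable.
Qed.

Lemma computable_baker_rhoA : effectively_computable baker_rhoA.
Proof.
rewrite /baker_rhoA; have := computable_baker_gA => ?; have := computable_baker_eta => ?.
by computable.
Qed.

Lemma computable_baker_LA : effectively_computable baker_LA.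
Proof.
rewrite /baker_LA; have := computable_baker_gA => ?; have := computable_baker_eta => ?.
by have := computable_baker_rhoA => ?; computable.
Qed.

Lemma computable_relation_A : effectively_computable relation_A.
Proof.
apply: computable_succ; apply: computable_comp; last by computable.
rewrite /baker_A; have := computable_baker_gA => ?; have := computable_baker_LA => ?.
by have := computable_baker_rhoA => ?; computable.
Qed.

Lemma computable_relation_B : effectively_computable relation_B.
Proof.
apply: computable_comp; last by computable.
by rewrite /baker_B; have := computable_baker_LB => ?; have := computable_baker_rhoB => ?;
  computable.
Qed.

Lemma computable_large_threshold : effectively_computable large_threshold.
Proof.
rewrite /large_threshold /large_coef; have := computable_relation_A => ?;
  have := computable_relation_B => ?.
by computable.
Qed.

Lemma computable_sparse_exponent : effectively_computable sparse_exponent.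
Proof.
rewrite /sparse_exponent /sparse_degree /sparse_coef.
by have := computable_large_threshold => ?; have := computable_relation_B => ?; computable.
Qed.

Lemma computable_top_exp : effectively_computable top_exp.
Proof.
rewrite /top_exp /scale_exp /max_large; have := computable_sparse_exponent => ?; by computable.
Qed.

Lemma computable_prime_bound : effectively_computable prime_bound.
Proof.
rewrite /prime_bound /large_exponent /max_large; have := computable_top_exp => ?.
by have := computable_large_threshold => ?; have := computable_relation_B => ?; computable.
Qed.

Lemma prime_factor_below k X Y a b : 0 < k -> 0 < X -> 0 < Y -> odd X -> (1 < X) || (1 < Y) ->
  sigma X = a * Y -> sigma Y = b * X ->
  sparse X (2 ^ sparse_exponent k) -> sparse Y (2 ^ sparse_exponent k) ->
  size [seq p <- primes X | (prime_bound k <= repunit p (logn p X).+1) && (p <= 2 ^ top_exp k)]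
    <= max_large k ->
  exists p, [/\ prime p, p %| Y & p < prime_bound k].
Proof.
move=> k0 X0 Y0 oX XY1 sX sY spX spY few.
have [/hasP [p]|/hasPn H] := boolP (has (fun p => p < prime_bound k) (primes Y)).
  by rewrite mem_primes => /and3P [pp _ pY] pb; exists p.
case: (scales_contradiction k0 X0 Y0 oX XY1 sX sY spX spY _ few) => q /H.
by rewrite -leqNgt.
Qed.

(** The pair N = M = 1 satisfies both equations with a = b = 1 and has no prime factors, so it is
    excluded. *)
Theorem theorem1p2 :
  exists C1 : nat -> nat,
    effectively_computable C1 /\
    forall k : nat,
      0 < C1 k /\
      forall (N M : nat) (a b : int),
        0 < N -> 0 < M ->
        ~ (N = 1 /\ M = 1) ->
        Posz (sigma N) = (a * Posz M)%R ->
        Posz (sigma M) = (b * Posz N)%R ->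
        omega (sigma N) <= k ->
        odd M -> odd N ->
        (exists p : nat, [/\ prime p, p %| M & p < C1 k]) /\
        (exists q : nat, [/\ prime q, q %| N & q < C1 k]).
Proof.
(* The value at k + 1, because the estimates take a positive number of primes. *)
exists (fun k => prime_bound k.+1); split.
  by apply: computable_comp computable_prime_bound _; apply: computable_succ; apply: computable_id.
move=> k; split; first by rewrite /prime_bound expn_gt0.
move=> N M a b N0 M0 NM1 /(congr1 absz); rewrite abszM !absz_nat => sN.
move=> /(congr1 absz); rewrite abszM !absz_nat => sM; rewrite /omega => om oM oN.
have k0 : 0 < k.+1 by [].
move: (k.+1) k0 (leqW om) => K K0 {}om.
have XY1 : (1 < N) || (1 < M).
  by apply/negbNE/negP; rewrite negb_or -!leqNgt => /andP [h1 h2]; apply: NM1; split; apply/eqP;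
    rewrite eqn_leq ?h1 ?h2.
have [P [uP aP sP sub]] := extend_primes (primes_uniq _) (all_prime_primes _) om.
have spN := sparse_smooth K0 N0 uP aP sP sub.
have sMK : size (primes M) <= K.
  apply: leq_trans om; apply: uniq_leq_size (primes_uniq _) _ => p; rewrite !mem_primes.
  by move=> /and3P [-> _ pM]; rewrite sigma_gt0 // sN dvdn_mull.
have spM := sparse_few K0 sMK.
have KK : K <= max_large K by rewrite /max_large -mulnA mulnCA leq_pmulr // muln_gt0.
split.
  apply: (prime_factor_below K0 N0 M0 oN XY1 sN sM spN spM).
  have t0 : 0 < top_exp K by rewrite /top_exp muln_gt0 expn_gt0 /scale_exp addn_gt0 orbT.
  have := count_large_exponents K0 N0 uP aP sP sub t0 => /ltnW; apply: leq_trans.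
  apply: uniq_leq_size; first by rewrite filter_uniq ?primes_uniq.
  move=> p; rewrite mem_filter => /andP [/andP [Cp pt] pN]; rewrite !mem_filter pt pN !andbT.
  have p1 : 1 < p by move: pN; rewrite mem_primes => /and3P [/prime_gt1].
  set y := top_exp K in t0 pt *.
  (* The first summand in the exponent of [prime_bound] is made for this: [repunit p E] < 2^(y E)
     forces E to be large. *)
  have : 2 ^ (y * large_exponent K y) < 2 ^ (y * (logn p N).+1).
    apply: (@leq_ltn_trans (prime_bound K)); first by rewrite leq_exp2l // -!addnA leq_addr.
    apply: (leq_ltn_trans Cp); apply: (leq_trans (repunit_ltX _ p1)).
    by rewrite expnM leq_exp2r.
  by rewrite ltn_exp2l // ltn_mul2l t0 => /ltnW.
(* With the roles exchanged, M has at most K <= [max_large K] prime factors in all, which bounds the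
   exceptional ones. *)
rewrite orbC in XY1; apply: (prime_factor_below K0 M0 N0 oM XY1 sM sN spM spN).
by apply: leq_trans KK; apply: leq_trans sMK; rewrite size_filter count_size.
Qed.
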